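(* Let $K_1,K_2$ be oriented knots in $\mathbb{S}^3$, let $\rho_j:\pi_1(K_j)\to\mathrm{PSL}(2,\mathbb{C})$ $(j=1,2)$ be boundary-parabolic representations with lifts $\widetilde{\rho_j}:\pi_1(K_j)\to\mathrm{SL}(2,\mathbb{C})$ sending meridians to matrices of trace two, and let $\widetilde{\rho_1}\#\widetilde{\rho_2}:\pi_1(K_1\#K_2)\to\mathrm{SL}(2,\mathbb{C})$ be the corresponding lift of any connected sum $\rho_1\#\rho_2$ of $\rho_1$ and $\rho_2$. Then the twisted Alexander polynomials satisfy $$\Delta_{K_1\#K_2,\,\widetilde{\rho_1}\#\widetilde{\rho_2}}(t)=(1-t)^2\,\Delta_{K_1,\,\widetilde{\rho_1}}(t)\,\Delta_{K_2,\,\widetilde{\rho_2}}(t),$$ where twisted Alexander polynomials are considered up to multiplication by $t^p$, $p\in\mathbb{Z}$.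
   Context: For an oriented knot $K\subset\mathbb{S}^3$, $\pi_1(K)=\pi_1(\mathbb{S}^3\setminus K)$; representations are considered up to conjugation. $\rho:\pi_1(K)\to\mathrm{PSL}(2,\mathbb{C})$ is boundary-parabolic if every meridian is sent to a parabolic (non-trivial) element. Let $D$ be an oriented diagram (at least one crossing) of $K$ with arcs $\alpha_1,\dots,\alpha_n$, viewed as Wirtinger (meridian) generators; the Wirtinger presentation is $\pi_1(K)=\langle\alpha_1,\dots,\alpha_n\mid r_1,\dots,r_{n-1}\rangle$, one of the $n$ crossing relations being redundant and removed. The crossing relation is $\alpha_{l'}=\alpha_k\alpha_l\alpha_k^{-1}$, where $\alpha_k$ is the over-arc, $\alpha_l$ the under-arc to the right of the oriented over-arc, $\alpha_{l'}$ the under-arc to its left; for the Fox calculus it is written as a relator word such as $\alpha_k\alpha_l\alpha_k^{-1}\alpha_{l'}^{-1}$. The arc-coloring of $D$ induced by $\rho$ is $\alpha_k\mapsto\rho(\alpha_k)$. Lift: $\widetilde\rho:\pi_1(K)\to\mathrm{SL}(2,\mathbb{C})$ is the lift of $\rho$ for which all $\widetilde\rho(\alpha_k)$ have trace $2$. Connected sum: $D_1\#D_2$ is formed by cutting an arc $\alpha$ of $D_1$ and an arc $\beta$ of $D_2$ and joining the ends compatibly with orientations by two connecting arcs. Conjugate $\rho_1,\rho_2$ so that $\rho_1(\alpha)=\rho_2(\beta)=a$, color the two connecting arcs by $a$ and let the other arcs keep their colors; the resulting representation of $\pi_1(K_1\#K_2)$ is called a connected sum $\rho_1\#\rho_2$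 (it may depend on the conjugations chosen). Its trace-two lift is $\widetilde{\rho_1}\#\widetilde{\rho_2}=\widetilde{\rho_1\#\rho_2}$. Twisted Alexander polynomial (Wada): let $\gamma:\pi_1(K)\to\langle t\rangle\cong\mathbb{Z}$ be the abelianization with $\gamma(\alpha_k)=t$ for all $k$. Let $\Phi:\mathbb{Z}[F_n]\to M(2,\mathbb{C}[t,t^{-1}])$, with $F_n$ free on $\alpha_1,\dots,\alpha_n$, be the ring homomorphism induced by $x\mapsto\widetilde\rho(x)\gamma(x)$. Let $M_{\widetilde\rho}$ be the $(n-1)\times n$ matrix of $2\times2$ blocks $\Phi\bigl(\frac{\partial r_k}{\partial\alpha_j}\bigr)$ (Fox derivatives), and $M_{\widetilde\rho,j}$ the matrix with the $j$-th block column removed. Then $$\Delta_{K,\widetilde\rho}(t)=\frac{\det M_{\widetilde\rho,j}}{\det\Phi(1-\alpha_j)},$$ which is independent of $j$ and well-defined up to multiplication by $t^p$, $p\in\mathbb{Z}$. *)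

(* Defs.v *)
From HB Require Import structures.
From mathcomp Require Import all_boot all_order all_algebra fraction.
From mathcomp Require Import reals complex.
Set Implicit Arguments.
Unset Strict Implicit.
Unset Printing Implicit Defensive.
Import GRing.Theory.
Local Open Scope ring_scope.
Local Open Scope quotient_scope.

Record SL2 (F : fieldType) := MkSL2 { sl2_mx :> 'M[F]_2; _ : \det sl2_mx == 1 }.

HB.instance Definition _ (F : fieldType) := [isSub for @sl2_mx F].
HB.instance Definition _ (F : fieldType) := [Choice of SL2 F by <:].

Section SL2Group.
Variable F : fieldType.
Implicit Types A B C : SL2 F.

Lemma det_SL2 A : \det (sl2_mx A) = 1.
Proof. by case: A => A /= /eqP. Qed.

Lemma unitmx_SL2 A : sl2_mx A \in unitmx.
Proof. by rewrite unitmxE det_SL2 unitr1. Qed.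

Fact SL2_one_subproof : \det (1%:M : 'M[F]_2) == 1.
Proof. by rewrite det1. Qed.

Fact SL2_mul_subproof A B : \det (sl2_mx A *m sl2_mx B) == 1.
Proof. by rewrite det_mulmx !det_SL2 mulr1. Qed.

Fact SL2_inv_subproof A : \det (invmx (sl2_mx A)) == 1.
Proof. by rewrite det_inv det_SL2 invr1. Qed.

Definition SL2_one := MkSL2 SL2_one_subproof.
Definition SL2_mul A B := MkSL2 (SL2_mul_subproof A B).
Definition SL2_inv A := MkSL2 (SL2_inv_subproof A).

Fact SL2_mulA : associative SL2_mul.
Proof. by move=> A B C; apply/val_inj/mulmxA. Qed.
Fact SL2_mul1 : left_id SL2_one SL2_mul.
Proof. by move=> A; apply/val_inj/mul1mx. Qed.
Fact SL2_mulr1 : right_id SL2_one SL2_mul.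
Proof. by move=> A; apply/val_inj/mulmx1. Qed.
Fact SL2_mulV : left_inverse SL2_one SL2_inv SL2_mul.
Proof. by move=> A; apply/val_inj/mulVmx/unitmx_SL2. Qed.
Fact SL2_mulrV : right_inverse SL2_one SL2_inv SL2_mul.
Proof. by move=> A; apply/val_inj/mulmxV/unitmx_SL2. Qed.

HB.instance Definition _ := isGroup.Build (SL2 F)
  SL2_mulA SL2_mul1 SL2_mulr1 SL2_mulV SL2_mulrV.

Definition psl2_eqv : rel (SL2 F) :=
  fun A B => (sl2_mx A == sl2_mx B) || (sl2_mx A == - sl2_mx B).

Fact psl2_eqv_refl : reflexive psl2_eqv.
Proof. by move=> A; rewrite /psl2_eqv eqxx. Qed.
Fact psl2_eqv_sym : symmetric psl2_eqv.
Proof.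
by move=> A B; rewrite /psl2_eqv eq_sym; congr orb; rewrite -eqr_oppLR eq_sym.
Qed.
Fact psl2_eqv_trans : transitive psl2_eqv.
Proof.
move=> B A C; rewrite /psl2_eqv.
case/orP => /eqP -> /orP [] /eqP ->; rewrite ?opprK eqxx ?orbT //.
Qed.

Canonical psl2_equiv := EquivRel psl2_eqv psl2_eqv_refl psl2_eqv_sym psl2_eqv_trans.

Definition PSL2 := {eq_quot psl2_eqv}.
HB.instance Definition _ := Choice.on PSL2.
HB.instance Definition _ := EqQuotient.on PSL2.

Definition PSL2_one : PSL2 := \pi_PSL2 SL2_one.
Definition PSL2_mul : PSL2 -> PSL2 -> PSL2 := lift_op2 PSL2 SL2_mul.
Definition PSL2_inv : PSL2 -> PSL2 := lift_op1 PSL2 SL2_inv.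

Lemma repr_PSL2 A : psl2_eqv (repr (\pi_PSL2 A)) A.
Proof. by apply/eqmodP; rewrite reprK. Qed.

Lemma pi_PSL2_mul : {morph \pi_PSL2 : A B / SL2_mul A B >-> PSL2_mul A B}.
Proof.
unlock PSL2_mul => A B; apply/eqmodP; rewrite /= /psl2_eqv /=.
by case/orP: (repr_PSL2 A) => /eqP ->; case/orP: (repr_PSL2 B) => /eqP ->;
   rewrite ?mulNmx ?mulmxN ?opprK eqxx ?orbT.
Qed.

Lemma invmxN n (A : 'M[F]_n) : A \in unitmx -> invmx (- A) = - invmx A.
Proof.
move=> uA; have uNA : - A \in unitmx by rewrite -scaleN1r unitmxZ ?unitrN1.
apply: (can_inj (mulKmx uNA)).
by rewrite mulmxV // mulNmx mulmxN opprK mulmxV.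
Qed.

Lemma pi_PSL2_inv : {morph \pi_PSL2 : A / SL2_inv A >-> PSL2_inv A}.
Proof.
unlock PSL2_inv => A; apply/eqmodP; rewrite /= /psl2_eqv /=.
by case/orP: (repr_PSL2 A) => /eqP ->; rewrite ?invmxN ?unitmx_SL2 // ?opprK
   eqxx ?orbT.
Qed.

Fact PSL2_mulA : associative PSL2_mul.
Proof.
elim/quotW=> A; elim/quotW=> B; elim/quotW=> C.
by rewrite -!pi_PSL2_mul SL2_mulA.
Qed.
Fact PSL2_mul1 : left_id PSL2_one PSL2_mul.
Proof. by elim/quotW=> A; rewrite -pi_PSL2_mul SL2_mul1. Qed.
Fact PSL2_mulr1 : right_id PSL2_one PSL2_mul.
Proof. by elim/quotW=> A; rewrite -pi_PSL2_mul SL2_mulr1. Qed.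
Fact PSL2_mulV : left_inverse PSL2_one PSL2_inv PSL2_mul.
Proof. by elim/quotW=> A; rewrite -pi_PSL2_inv -pi_PSL2_mul SL2_mulV. Qed.
Fact PSL2_mulrV : right_inverse PSL2_one PSL2_inv PSL2_mul.
Proof. by elim/quotW=> A; rewrite -pi_PSL2_inv -pi_PSL2_mul SL2_mulrV. Qed.

HB.instance Definition _ := isGroup.Build PSL2
  PSL2_mulA PSL2_mul1 PSL2_mulr1 PSL2_mulV PSL2_mulrV.

(* The squared trace does not depend on the sign of the representative. *)
Definition parabolic (x : PSL2) : Prop :=
  x <> 1%g /\ (\tr (sl2_mx (repr x))) ^+ 2 = 4%:R.

End SL2Group.

(* An oriented diagram with n crossings is given by its signed Gauss code.  The knot runs
  through every crossing twice; [(c, true)] is the passage over c, [(c, false)]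
  the passage under c.  [next p] is the passage met right after p when one
  follows the orientation, so the 2n edges of the diagram (the segments between
  consecutive passages) are identified with the passages they leave. *)

Definition passage (n : nat) : finType := ('I_n * bool)%type.

Record diagram (n : nat) := Diagram {
  next : passage n -> passage n;
  positive : 'I_n -> bool (* the sign of the crossing *)
}.

(* The half-edge [(p, true)] leaves the passage p and [(p, false)] enters it. *)
Definition half_edge (n : nat) : finType := (passage n * bool)%type.

Definition other_half n (D : diagram n) (h : half_edge n) : half_edge n :=
  if h.2 then (next D h.1, false) else (finv (next D) h.1, true).

(* Counterclockwise rotation around a crossing.  Around a positive crossing the
   cyclic order is over-out, under-out, over-in, under-in; around a negative
   one it is over-out, under-in, over-in, under-out. *)
Definition rotate n (D : diagram n) (h : half_edge n) : half_edge n :=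
  let: (c, over, out) := h in
  (c, ~~ over, if over == positive D c then out else ~~ out).

(* The orbits of [face_next] are the boundaries of the faces of the diagram on
   the closed oriented surface determined by [rotate]. *)
Definition face_next n (D : diagram n) (h : half_edge n) : half_edge n :=
  rotate D (other_half D h).

(* A single closed component; the surface is a sphere by Euler's formula
   n - 2n + #faces = 2, which excludes virtual knots. *)
Definition knot_diagram n (D : diagram n) : Prop :=
  (forall p q : passage n, fconnect (next D) p q) /\
  fcard (face_next D) [set: half_edge n] = (n + 2)%N.

(* Every arc starts at exactly one undercrossing, and (for a knot with n > 0) every
  undercrossing starts exactly one arc; arcs are labelled accordingly by 'I_n. *)

(* The arc containing the edge that leaves p, found by going backwards to the
   first underpassage. *)
Definition arc n (D : diagram n) (p : passage n) : 'I_n :=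
  (head p [seq q <- orbit (finv (next D)) p | ~~ q.2]).1.

Definition over_arc n (D : diagram n) (c : 'I_n) := arc D (c, true).
Definition under_in n (D : diagram n) (c : 'I_n) :=
  arc D (finv (next D) (c, false)).
Definition under_out n (D : diagram n) (c : 'I_n) := arc D (c, false).

(* The under-arcs to the right and to the left of the oriented over-arc: at a
   positive crossing the under-strand passes from right to left. *)
Definition right_arc n (D : diagram n) (c : 'I_n) :=
  if positive D c then under_in D c else under_out D c.
Definition left_arc n (D : diagram n) (c : 'I_n) :=
  if positive D c then under_out D c else under_in D c.

(* Words in the generators: [(i, false)] stands for x_i, [(i, true)] for its
   inverse. *)
Definition word (n : nat) := seq ('I_n * bool).

Definition relator n (D : diagram n) (c : 'I_n) : word n :=
  [:: (over_arc D c, false); (right_arc D c, false);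
      (over_arc D c, true); (left_arc D c, true)].

Definition eval_word (G : groupType) n (f : 'I_n -> G) (w : word n) : G :=
  (\prod_(x <- w) (if x.2 then (f x.1)^-1 else f x.1))%g.

(* A homomorphism from the knot group to G is given by the images of the
   Wirtinger generators, i.e. by an arc-coloring satisfying the relations. *)
Definition representation (G : groupType) n (D : diagram n) (f : 'I_n -> G) :
  Prop := forall c, eval_word f (relator D c) = 1%g.

Definition boundary_parabolic (F : fieldType) n (D : diagram n)
    (rho : 'I_n -> PSL2 F) : Prop :=
  representation D rho /\ forall k, parabolic (rho k).

Definition trace_two_lift (F : fieldType) n (D : diagram n)
    (rho : 'I_n -> PSL2 F) (lrho : 'I_n -> SL2 F) : Prop :=
  [/\ representation D lrho,
      forall k, \pi_(PSL2 F) (lrho k) = rho k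
    & forall k, \tr (sl2_mx (lrho k)) = 2%:R].

Definition lpassage n1 n2 (p : passage n1) : passage (n1 + n2) :=
  (lshift n2 p.1, p.2).
Definition rpassage n1 n2 (p : passage n2) : passage (n1 + n2) :=
  (rshift n1 p.1, p.2).

(* D1 is cut on the edge leaving the passage e1 and D2 on the edge leaving e2. *)
Definition csum_next n1 n2 (D1 : diagram n1) (D2 : diagram n2)
    (e1 : passage n1) (e2 : passage n2) (p : passage (n1 + n2)) :
    passage (n1 + n2) :=
  match split p.1 with
  | inl c => if (c, p.2) == e1 then rpassage n1 (next D2 e2)
             else lpassage n2 (next D1 (c, p.2))
  | inr c => if (c, p.2) == e2 then lpassage n2 (next D1 e1)
             else rpassage n1 (next D2 (c, p.2))
  end.

Definition csum_diagram n1 n2 (D1 : diagram n1) (D2 : diagram n2)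
    (e1 : passage n1) (e2 : passage n2) : diagram (n1 + n2) :=
  Diagram (csum_next D1 D2 e1 e2)
    (fun c => match split c with inl i => positive D1 i | inr i => positive D2 i end).

(* The two connecting arcs of the sum start where the two cut arcs did, so that
   their colors below are f1 (arc D1 e1) and f2 (arc D2 e2). *)
Definition csum_coloring (T : Type) n1 n2 (f1 : 'I_n1 -> T) (f2 : 'I_n2 -> T)
    (k : 'I_(n1 + n2)) : T :=
  match split k with inl i => f1 i | inr i => f2 i end.

Definition connected_sum_rep (G : groupType) n1 n2
    (D1 : diagram n1) (D2 : diagram n2) (e1 : passage n1) (e2 : passage n2)
    (rho1 : 'I_n1 -> G) (rho2 : 'I_n2 -> G) (rho : 'I_(n1 + n2) -> G) : Prop :=
  exists g1 g2 : G,
    (rho1 (arc D1 e1) ^ g1 = rho2 (arc D2 e2) ^ g2)%g /\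
    rho =1 csum_coloring (fun i => rho1 i ^ g1)%g (fun i => rho2 i ^ g2)%g.

(* Elements of the group ring Z[F_n], written as formal Z-linear combinations
   of words that need not be reduced; [Phi] below is invariant under free
   reduction. *)
Definition zword (n : nat) := seq (int * word n).

(* d(uv) = du + u dv, dx_i/dx_j = delta_ij, dx_i^-1/dx_j = - delta_ij x_i^-1 *)
Fixpoint fox n (j : 'I_n) (w : word n) : zword n :=
  match w with
  | [::] => [::]
  | x :: v =>
      (if x.1 == j then [:: if x.2 then (-1, [:: x]) else (1, [::])] else [::])
      ++ [seq (m.1, x :: m.2) | m <- fox j v]
  end.

(* The Laurent polynomials over F, and the quotient defining the invariant, live
  in the field F(t) of rational functions. *)

Notation ratfun F := {fraction {poly F}}.

Definition tvar (F : fieldType) : ratfun F := tofrac 'X.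

(* The abelianization sends w to t ^ exponent w. *)
Definition exponent n (w : word n) : int :=
  \sum_(x <- w) (if x.2 then -1 else 1).

Definition Phi (F : fieldType) n (lrho : 'I_n -> SL2 F) (z : zword n) :
    'M[ratfun F]_2 :=
  \sum_(m <- z)
    (tvar F ^ exponent m.2 *:
       map_mx (fun a : F => tofrac a%:P) (sl2_mx (eval_word lrho m.2))) *~ m.1.

(* c is the crossing whose (redundant) relation is left out of the presentation
   and j the generator whose block column is removed. *)
Definition alexander_mx (F : fieldType) n (D : diagram n.+1)
    (lrho : 'I_n.+1 -> SL2 F) (c j : 'I_n.+1) :=
  \mxblock_(i < n, k < n) Phi lrho (fox (lift j k) (relator D (lift c i))).

Definition twisted_alexander (F : fieldType) n (D : diagram n.+1)
    (lrho : 'I_n.+1 -> SL2 F) (c j : 'I_n.+1) : ratfun F :=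
  \det (alexander_mx D lrho c j)
  / \det (Phi lrho [:: (1, [::]); (-1, [:: (j, false)])]).

Definition eq_up_to_tpow (F : fieldType) (f g : ratfun F) : Prop :=
  exists p : int, f = tvar F ^ p * g.

(* Main.v *)
From HB Require Import structures.
From mathcomp Require Import all_boot all_order all_algebra fraction.
From mathcomp Require Import perm reals complex ring zify.
Require Import Defs.
Set Implicit Arguments.
Unset Strict Implicit.
Unset Printing Implicit Defensive.
Import GRing.Theory.
Local Open Scope ring_scope.

(* Write X k = t * rho(alpha_k).  The right kernel of the full n x n block Fox
   matrix A contains the column (1 - X k); its left kernel contains a row B whose
   entries are, up to sign, products of the X's and their inverses, namely the values
   at the faces near the crossings of a flat section of the local system on the
   sphere determined by the coloring.  That this local system is trivial is the only
   use of planarity: by an Euler characteristic count h^0 + h^2 >= 2d, while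
   h^2 <= d because the diagram is connected.  The two kernels show that the
   block minors of A do not depend, up to powers of t, on the row and column removed.

   In the sum, removing a row of D1 and the column of the first connecting arc leaves a
   block triangular matrix.  Its upper block is a minor of A1; its lower block Z is A2
   with the column of the cut arc replaced by the contributions of one of the two
   pieces of that arc.  Along this piece the sum of the B-weighted contributions
   telescopes to the invertible weight of the face at the cut, so B Z is
   concentrated in one column and det Z equals a minor of A2 up to a power of t.
   Each Delta is such a minor divided by det(1 - X) = (1 - t)^2. *)

(** * Determinants of block matrices indexed by finite types *)

Section FinTypeDet.
Variable R : comNzRingType.

(** Arbitrary finite index types let block decompositions be sums and products of types, without
    casts between ordinals. *)
Definition fdet (T : finType) (M : T -> T -> R) : R :=
  \det (\matrix_(i, j < #|T|) M (enum_val i) (enum_val j)).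

Lemma eq_fdet (T : finType) (M N : T -> T -> R) : M =2 N -> fdet M = fdet N.
Proof.
by move=> eqMN; congr (\det _); apply/matrixP=> i j; rewrite !mxE eqMN.
Qed.

(** Another enumeration applies one permutation to rows and columns alike, so the two signs
    cancel. *)
Lemma fdet_enum m (T : finType) (f : 'I_m -> T) (M : T -> T -> R) :
  bijective f -> \det (\matrix_(i, j) M (f i) (f j)) = fdet M.
Proof.
move=> bij_f; have em : m = #|T| by rewrite -(bij_eq_card bij_f) card_ord.
subst m; have inj_s : injective (enum_rank \o f).
  by apply: inj_comp; [exact: enum_rank_inj | exact: bij_inj].
pose s := perm inj_s.
have -> : \matrix_(i, j) M (f i) (f j) =
    row_perm s (col_perm s (\matrix_(i, j) M (enum_val i) (enum_val j))).
  by apply/matrixP=> i j; rewrite !mxE !permE /= !enum_rankK.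
rewrite row_permE col_permE !det_mulmx !det_perm odd_permV mulrCA -signr_addb.
by rewrite addbb mulr1.
Qed.

Lemma fdet_bij (T U : finType) (f : T -> U) (M : U -> U -> R) :
  bijective f -> fdet (fun i j => M (f i) (f j)) = fdet M.
Proof.
move=> bij_f; rewrite -(@fdet_enum _ _ (fun i : 'I_#|T| => f (enum_val i)) M) //.
exact: bij_comp bij_f (@enum_val_bij T).
Qed.

Lemma fdet_tr (T : finType) (M : T -> T -> R) :
  fdet (fun i j => M j i) = fdet M.
Proof.
by rewrite /fdet -det_tr; congr (\det _); apply/matrixP=> i j; rewrite !mxE.
Qed.

Lemma fdetM (T : finType) (M N : T -> T -> R) :
  fdet (fun i k => \sum_j M i j * N j k) = fdet M * fdet N.
Proof.
rewrite /fdet -det_mulmx; congr (\det _); apply/matrixP=> i k; rewrite !mxE.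
rewrite (reindex (@enum_val T T)) /=; last exact: onW_bij (@enum_val_bij T).
by apply: eq_bigr => j _; rewrite !mxE.
Qed.

Lemma fdet1 (T : finType) : fdet (fun i j : T => (i == j)%:R) = 1.
Proof.
rewrite /fdet -[RHS](det1 _ #|T|); congr (\det _); apply/matrixP=> i j.
by rewrite !mxE (inj_eq enum_val_inj).
Qed.

Lemma fdet_sum (T U : finType) (M : T + U -> T + U -> R) :
    (forall i j, M (inr i) (inl j) = 0) ->
  fdet M = fdet (fun i j => M (inl i) (inl j)) * fdet (fun i j => M (inr i) (inr j)).
Proof.
move=> M0; pose f (k : 'I_(#|T| + #|U|)) : T + U :=
  match split k with inl i => inl (enum_val i) | inr i => inr (enum_val i) end.
have bij_f : bijective f.
  exists (fun x => unsplit (match x with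
    inl i => inl (enum_rank i) | inr i => inr (enum_rank i) end)).
    by move=> k; rewrite /f -{2}(splitK k); case: split => i; rewrite enum_valK.
  by rewrite /f; case=> i; rewrite unsplitK enum_rankK.
rewrite -(fdet_enum M bij_f) -[X in \det X]submxK.
rewrite [X in block_mx _ _ X _](_ : _ = 0); last first.
  apply/matrixP=> i j; rewrite !mxE /f.
  by rewrite (unsplitK (inl _)) (unsplitK (inr _)) M0.
rewrite det_ublock /fdet; congr (_ * _); congr (\det _); apply/matrixP=> i j;
  rewrite !mxE /f.
  by rewrite !(unsplitK (inl _)).
by rewrite !(unsplitK (inr _)).
Qed.

Lemma fdet_ord n (M : 'M[R]_n) : fdet (fun i j => M i j) = \det M.
Proof.
rewrite -(@fdet_enum n _ id); last by exists id.
by congr (\det _); apply/matrixP=> i j; rewrite !mxE.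
Qed.

Definition bdet (I : finType) d (A : I -> I -> 'M[R]_d) : R :=
  fdet (fun x y : I * 'I_d => A x.1 y.1 x.2 y.2).

Lemma eq_bdet (I : finType) d (A B : I -> I -> 'M[R]_d) :
  A =2 B -> bdet A = bdet B.
Proof. by move=> eqAB; apply: eq_fdet => x y; rewrite eqAB. Qed.

Lemma bdet_mxblock n d (A : 'I_n -> 'I_n -> 'M[R]_d) :
  \det (\mxblock_(i < n, j < n) A i j) = bdet A.
Proof.
pose f (s : 'I_(\sum_(i < n) d)) : 'I_n * 'I_d := (tagnat.sig1 s, tagnat.sig2 s).
rewrite /bdet -(@fdet_enum _ _ f).
  by congr (\det _); apply/matrixP=> i j; rewrite !mxE.
exists (fun x => @tagnat.Rank n (fun=> d) x.1 x.2) => [s | [i a]] /=.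
  exact: tagnat.sig2K.
rewrite /f tagnat.Rank1K; congr (_, _).
by apply: val_inj; rewrite tagnat.Rank2K.
Qed.

Lemma bdet_bij (I J : finType) d (f : I -> J) (A : J -> J -> 'M[R]_d) :
  bijective f -> bdet (fun i j => A (f i) (f j)) = bdet A.
Proof.
case=> g fK gK; rewrite /bdet -(@fdet_bij _ _ (fun x : I * 'I_d => (f x.1, x.2))) //.
by exists (fun x => (g x.1, x.2)) => -[i a] /=; rewrite ?fK ?gK.
Qed.

Lemma bdet_tr (I : finType) d (A : I -> I -> 'M[R]_d) :
  bdet (fun i j => (A j i)^T) = bdet A.
Proof. by rewrite /bdet -fdet_tr; apply: eq_fdet => x y; rewrite mxE. Qed.

Lemma bdetM (I : finType) d (A B : I -> I -> 'M[R]_d) :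
  bdet (fun i k => \sum_j A i j *m B j k) = bdet A * bdet B.
Proof.
rewrite -fdetM; apply: eq_fdet => x y.
rewrite summxE; under eq_bigr do rewrite mxE.
by rewrite (pair_big predT predT (fun j a => A x.1 j x.2 a * B j y.1 a y.2)).
Qed.

Lemma bdet1 (I : finType) d : bdet (fun i j : I => (i == j)%:R%:M : 'M[R]_d) = 1.
Proof.
rewrite -[RHS](fdet1 (I * 'I_d)%type); apply: eq_fdet => -[i a] [j b] /=.
by rewrite xpair_eqE !mxE; case: (i == j); case: (a == b).
Qed.

Lemma bdet_sum (I J : finType) d (A : I + J -> I + J -> 'M[R]_d) :
    (forall i j, A (inr i) (inl j) = 0) ->
  bdet A = bdet (fun i j => A (inl i) (inl j)) * bdet (fun i j => A (inr i) (inr j)).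
Proof.
move=> A0; pose f (x : I * 'I_d + J * 'I_d) : (I + J) * 'I_d :=
  match x with inl x => (inl x.1, x.2) | inr x => (inr x.1, x.2) end.
rewrite /bdet -(@fdet_bij _ _ f); last first.
  exists (fun y => match y with (inl i, a) => inl (i, a) | (inr i, a) => inr (i, a) end).
    by case=> -[].
  by case=> -[].
by rewrite fdet_sum // => x y /=; rewrite A0 mxE.
Qed.

Lemma bdet_unit d (A : unit -> unit -> 'M[R]_d) : bdet A = \det (A tt tt).
Proof.
rewrite -fdet_ord /bdet -(@fdet_bij 'I_d _ (fun a => (tt, a))) //.
by exists snd => [a | [[] a]].
Qed.

(* A permutation matrix with 2x2 scalar blocks is conjugate to [diag(S, S)]. *)
Lemma bdet_perm (I : finType) (s : I -> I) : bijective s ->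
  bdet (fun i j => (s i == j)%:R%:M : 'M[R]_2) = 1.
Proof.
move=> bij_s; pose f (x : I + I) : I * 'I_2 :=
  match x with inl i => (i, 0) | inr i => (i, 1) end.
rewrite /bdet -(@fdet_bij _ _ f); last first.
  exists (fun y => if y.2 == 0 then inl y.1 else inr y.1); first by case.
  case=> i a /=; case: (eqVneq a 0) => [-> // | a_neq0] /=.
  by congr (_, _); apply: val_inj; case: a a_neq0 => -[|[|]].
rewrite fdet_sum => [|i j] /=; last by rewrite !mxE /= mulr0n.
transitivity (fdet (fun i j : I => (s i == j)%:R) ^+ 2 : R).
  by rewrite expr2; congr (_ * _); apply: eq_fdet => i j; rewrite !mxE eqxx mulr1n.
rewrite expr2 -{2}fdet_tr -fdetM -[RHS](fdet1 I); apply: eq_fdet => i j.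
rewrite (bigD1 (s i)) //= eqxx mul1r big1 ?addr0 => [|k].
  by rewrite (inj_eq (bij_inj bij_s)) eq_sym.
by rewrite eq_sym => /negPf->; rewrite mul0r.
Qed.

(** Rows and columns may be relabelled independently: the sign of a permutation enters once for each
    of the two coordinates of a block, hence squared. *)
Lemma bdet_reindex (I J : finType) (f g : I -> J) (A : J -> J -> 'M[R]_2) :
    bijective f -> bijective g ->
  bdet (fun i j => A (f i) (g j)) = bdet A.
Proof.
move=> bij_f bij_g; rewrite -(bdet_bij A bij_f).
have [g' gK g'K] := bij_g.
have bij_s : bijective (g' \o f) by apply: bij_comp bij_f; exists g.
rewrite -[RHS]mulr1 -(bdet_perm bij_s) -bdetM; apply: eq_bdet => i k.
case: bij_f => f' fK f'K; rewrite (bigD1 (f' (g k))) //= f'K gK eqxx mulmx1.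
rewrite big1 ?addr0 // => j /eqP neq; rewrite (can2_eq g'K gK).
case: eqP => [eq_fj | _]; last by rewrite -scalemx1 scale0r mulmx0.
by case: neq; rewrite -eq_fj fK.
Qed.

(** * Block minors and the choice of the removed row and column *)

Definition bminor n d (A : 'I_n.+1 -> 'I_n.+1 -> 'M[R]_d) (c j : 'I_n.+1) : R :=
  bdet (fun i k : 'I_n => A (lift c i) (lift j k)).

Definition lift_option n (c : 'I_n.+1) (x : 'I_n + unit) : 'I_n.+1 :=
  if x is inl i then lift c i else c.

Lemma lift_option_bij n (c : 'I_n.+1) : bijective (lift_option c).
Proof.
exists (fun k => if unlift c k is Some i then inl i else inr tt).
  by case=> [i|[]] /=; rewrite ?liftK ?unlift_none.
by move=> k; case: (unliftP c k) => [i ->|->].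
Qed.

Lemma bdet_row n (A : 'I_n.+1 -> 'I_n.+1 -> 'M[R]_2) c j :
  (forall k, k != j -> A c k = 0) -> bdet A = \det (A c j) * bminor A c j.
Proof.
move=> A0; rewrite -(bdet_reindex A (lift_option_bij c) (lift_option_bij j)).
rewrite bdet_sum /= => [|[] k]; last by rewrite A0 // eq_sym neq_lift.
by rewrite mulrC bdet_unit.
Qed.

Lemma bdet_col n (A : 'I_n.+1 -> 'I_n.+1 -> 'M[R]_2) c j :
  (forall i, i != c -> A i j = 0) -> bdet A = \det (A c j) * bminor A c j.
Proof.
move=> A0; rewrite -bdet_tr (@bdet_row _ _ j c) => [|i /A0->]; last exact: trmx0.
by rewrite det_tr /bminor bdet_tr.
Qed.

Lemma bdet_comb_row n (A : 'I_n.+1 -> 'I_n.+1 -> 'M[R]_2) (B : 'I_n.+1 -> 'M[R]_2)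
    (M : 'M[R]_2) c j :
    (forall k, \sum_i B i *m A i k = if k == j then M else 0) ->
  \det (B c) * bdet A = \det M * bminor A c j.
Proof.
(* [L] is the identity with row [c] replaced by [B], so row [c] of the product of [L] and [A] is [M]
   in column [j] and zero elsewhere. *)
move=> BA; pose L (i k : 'I_n.+1) := if i == c then B k else (i == k)%:R%:M : 'M[R]_2.
have detL : bdet L = \det (B c).
  rewrite (@bdet_col _ _ c c) /L ?eqxx => [|i ic]; last first.
    by rewrite (negPf ic) -scalemx1 scale0r.
  rewrite [bminor _ _ _](_ : _ = 1) ?mulr1 // -[RHS](bdet1 'I_n 2).
  by apply: eq_bdet => i k; rewrite eq_sym (negPf (neq_lift c i)) (inj_eq lift_inj).
rewrite -detL -bdetM (@bdet_row _ _ c j) => [|k kj]; last first.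
  by rewrite /L eqxx BA (negPf kj).
rewrite {1}/L eqxx BA eqxx; congr (_ * _); apply: eq_bdet => i k.
rewrite /L eq_sym (negPf (neq_lift c i)) (bigD1 (lift c i)) //= eqxx mul1mx.
rewrite big1 ?addr0 // => l; rewrite eq_sym => /negPf->.
by rewrite -scalemx1 scale0r mul0mx.
Qed.

(* Both sides compute the determinant of [A] with its block column [j] replaced
   by the unit column at [c']. *)
Lemma bminor_row_exchange n (A : 'I_n.+1 -> 'I_n.+1 -> 'M[R]_2)
    (B : 'I_n.+1 -> 'M[R]_2) c c' j :
    (forall k, \sum_i B i *m A i k = 0) ->
  \det (B c) * bminor A c' j = \det (B c') * bminor A c j.
Proof.
move=> BA; pose Y i k := if k == j then (i == c')%:R%:M : 'M[R]_2 else A i k.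
have minorY i : bminor Y i j = bminor A i j.
  by apply: eq_bdet => i' k; rewrite /Y eq_sym (negPf (neq_lift j k)).
rewrite -!minorY -(@bdet_comb_row _ Y B _ c j) => [|k].
  congr (_ * _); rewrite (@bdet_col _ _ c' j) /Y ?eqxx ?det1 ?mul1r //.
  by move=> i /negPf->; rewrite -scalemx1 scale0r.
rewrite /Y; case: eqP => // _; rewrite (bigD1 c') //= eqxx mulmx1 big1 ?addr0 //.
by move=> i /negPf->; rewrite -scalemx1 scale0r mulmx0.
Qed.

Lemma bminor_col_exchange n (A : 'I_n.+1 -> 'I_n.+1 -> 'M[R]_2)
    (C : 'I_n.+1 -> 'M[R]_2) c j j' :
    (forall i, \sum_k A i k *m C k = 0) ->
  \det (C j) * bminor A c j' = \det (C j') * bminor A c j.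
Proof.
move=> AC; have minor_tr k : bminor A c k = bminor (fun i j => (A j i)^T) k c.
  by rewrite /bminor -bdet_tr.
rewrite !minor_tr -(det_tr (C j)) -(det_tr (C j')).
apply: (@bminor_row_exchange _ _ (fun k => (C k)^T)) => k.
transitivity ((\sum_i A k i *m C i)^T); last by rewrite AC trmx0.
by rewrite raddf_sum; apply: eq_bigr => i _; rewrite /= trmx_mul.
Qed.

(** The block diagonal matrices built from [P] and [Q] have product 1, so their determinants
    cancel. *)
Lemma bdet_conj (I : finType) d (P Q : 'M[R]_d) (A : I -> I -> 'M[R]_d) :
  P *m Q = 1%:M -> bdet (fun i j => P *m A i j *m Q) = bdet A.
Proof.
move=> PQ; pose diag (S : 'M[R]_d) (i j : I) := if i == j then S else 0.
have diagL S (B : I -> I -> 'M[R]_d) i k : \sum_j diag S i j *m B j k = S *m B i k.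
  rewrite (bigD1 i) //= /diag eqxx big1 ?addr0 // => j.
  by rewrite eq_sym => /negPf->; rewrite mul0mx.
have diagR S (B : I -> I -> 'M[R]_d) i k : \sum_j B i j *m diag S j k = B i k *m S.
  rewrite (bigD1 k) //= /diag eqxx big1 ?addr0 // => j.
  by move=> /negPf->; rewrite mulmx0.
have detPQ : bdet (diag P) * bdet (diag Q) = 1.
  rewrite -bdetM -[RHS](bdet1 I d); apply: eq_bdet => i j.
  by rewrite diagL /diag; case: eqP => _; rewrite ?PQ // mulmx0 -scalemx1 scale0r.
rewrite -[RHS]mul1r -detPQ mulrAC -!bdetM; apply: eq_bdet => i j.
by rewrite (diagR _ (fun i k => \sum_l diag P i l *m A l k)) diagL.
Qed.

End FinTypeDet.

(** * Arcs and half-edges *)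

Section Diagrams.
Variables (n : nat) (D : diagram n).
Implicit Types (p q : passage n) (h : half_edge n).

Local Notation prev := (finv (next D)).

(** The backward walk from a passage to the start of its arc, with its number of steps. Induction on
    it compares arcs of different diagrams, and the step count detects a walk that would return to
    its origin. *)
Inductive arc_back : nat -> passage n -> 'I_n -> Prop :=
| ArcUnder c : arc_back 0 (c, false) c
| ArcOver m c a : arc_back m (prev (c, true)) a -> arc_back m.+1 (c, true) a.

Lemma arc_back_unique m m' p a a' :
  arc_back m p a -> arc_back m' p a' -> m = m'.
Proof.
move=> ba; elim: ba m' => [c|{}m c {}a _ IH] m' ba'.
  by inversion ba'.
by inversion ba'; subst; congr _.+1; apply: IH.
Qed.

Lemma next_surj_inj : (forall q, exists p, next D p = q) -> injective (next D).
Proof.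
move=> surj; apply: in2T; apply/image_injP/eqP/eq_card => q; rewrite inE.
by have [p <-] := surj q; apply/codomP; exists p.
Qed.

(** A path from [next D q] back to [q] yields a predecessor of [q], and a surjection of a finite set
    onto itself is injective. *)
Lemma transitive_inj : (forall p q, fconnect (next D) p q) -> injective (next D).
Proof.
move=> conn; apply: next_surj_inj => q.
have := conn (next D q) q => /iter_findex; rewrite -iterSr iterS.
by move <-; eexists.
Qed.

Hypothesis next_inj : injective (next D).

Lemma arc_under c : arc D (c, false) = c.
Proof. by rewrite /arc /orbit -orderSpred. Qed.

(** The backward orbits of the two passages are the same cycle, with [(c, true)] moved from the
    front to the end; being an overpassage, it is filtered out of both. The underpassage [q] keeps
    the filtered list nonempty, so the different default values of [head] are never reached. *)
Lemma arc_step c : (exists2 q, fconnect prev (c, true) q & ~~ q.2) ->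
  arc D (c, true) = arc D (prev (c, true)).
Proof.
case=> q; set p := (c, true); have g_inj := finv_inj next_inj.
rewrite fconnect_orbit /arc => q_orb q_under.
have ordE : order prev (prev p) = order prev p.
  by apply: eq_card => x; rewrite !inE -same_fconnect1.
have [k ordp] : exists k, order prev p = k.+1.
  by exists (order prev p).-1; rewrite orderSpred.
have iter_p : iter k.+1 prev p = p by rewrite -ordp iter_order.
rewrite /orbit ordE ordp in q_orb *.
rewrite (trajectSr _ (prev p)) -iterSr iter_p filter_rcons /=.
move: q_orb; rewrite inE => /predU1P[eq_q | q_in]; first by rewrite eq_q in q_under.
have: q \in [seq q <- traject prev (prev p) k | ~~ q.2].
  by rewrite mem_filter q_under.
by case: filter.
Qed.

Lemma arc_backP m p a : arc_back m p a -> arc D p = a.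
Proof.
(* The added connectivity claim supplies the underpassage that [arc_step] asks for. *)
move=> ba; suff [] : arc D p = a /\ fconnect prev p (a, false) by [].
elim: ba => {m p a} [c|m c a _ [IH1 IH2]]; first by rewrite arc_under connect0.
have conn : fconnect prev (c, true) (a, false).
  by apply: connect_trans IH2; apply: fconnect1.
by split=> //; rewrite arc_step //; exists (a, false).
Qed.

Lemma arc_over_prev m c a :
  arc_back m (c, true) a -> arc D (c, true) = arc D (prev (c, true)).
Proof.
move=> ba; rewrite (arc_backP ba).
by inversion ba as [|? ? ? ba']; rewrite (arc_backP ba').
Qed.

Lemma arc_back_exists p : (forall p q, fconnect (next D) p q) ->
  exists m, arc_back m p (arc D p).
Proof.
move=> conn; have c0 : 'I_n := p.1.
suff [m [a ba]] : exists m a, arc_back m p a.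
  by exists m; rewrite (arc_backP ba).
have: fconnect prev p (c0, false) by rewrite (same_fconnect_finv next_inj).
move/iter_findex; move: (findex _ _ _) => k; elim: k p => [|k IH] p.
  by move=> /= ->; exists 0%N, c0; constructor.
rewrite iterSr => /IH[m [a ba]]; case: p ba => c [] ba.
  by exists m.+1, a; constructor.
by exists 0%N, c; constructor.
Qed.

Lemma other_halfK : involutive (other_half D).
Proof.
by case=> p []; rewrite /other_half /= ?(finv_f next_inj) ?(f_finv next_inj).
Qed.

Lemma rotate_inj : injective (rotate D).
Proof.
move=> [[c o] b] [[c' o'] b']; rewrite /rotate => -[-> ].
by case: o; case: o'; case: (positive D c') => //=; case: b; case: b'.
Qed.

Lemma face_next_inj : injective (face_next D).
Proof. exact: inj_comp rotate_inj (inv_inj other_halfK). Qed.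

(** [rotate D] is [face_next D] after the involution [other_half D], so [P] also propagates around a
    crossing. Three rotations reach all four half-edges there, and edges lead on to every other
    crossing. *)
Lemma half_edge_ind (P : half_edge n -> Prop) h0 :
    (forall p q, fconnect (next D) p q) ->
    (forall h, P h -> P (face_next D h)) ->
    (forall p, P (p, true) <-> P (next D p, false)) ->
  P h0 -> forall h, P h.
Proof.
move=> conn Pface Pedge Ph0.
have Pother h : P h -> P (other_half D h).
  case: h => p []; rewrite /other_half /= => Ph; first exact/Pedge.
  by apply/Pedge; rewrite (f_finv next_inj).
have Prot h : P h -> P (rotate D h).
  by move=> /Pother /Pface; rewrite /face_next other_halfK.
have Pvertex c o b o' b' : P (c, o, b) -> P (c, o', b').
  move=> P0; have P1 := Prot _ P0; have P2 := Prot _ P1; have := Prot _ P2.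
  move: P0 P1 P2; rewrite /rotate.
  by case: o; case: o'; case: b; case: b'; case: (positive D c).
suff Pall p : forall o b, P (p.1, o, b) by case=> -[c o] b; apply: (Pall (c, o)).
have: fconnect (next D) h0.1 p by [].
move/iter_findex => <-; elim: (findex _ _ _) => [|k IH] o b.
  by case: h0 Ph0 => -[c o'] b'; apply: Pvertex.
rewrite iterS; move: (iter k _ _) IH => q IH.
apply: (Pvertex _ (next D q).2 false); rewrite -surjective_pairing.
by apply/Pedge; case: q IH => c o' IH; apply: IH.
Qed.

End Diagrams.

(** * Flat sections on the sphere *)

Lemma telescope4 (V : zmodType) (a b c e : V) :
  a - b - (c - e) + (b - e - (a - c)) = 0.
Proof.
apply/eqP; rewrite addr_eq0 !opprB addrACA [in eqbRHS]addrACA.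
by rewrite [X in _ == _ + X]addrC.
Qed.

Section FlatSections.
Variables (K : fieldType) (d n : nat) (D : diagram n) (X : 'I_n -> 'M[K]_d).
Hypotheses (knotD : knot_diagram D) (unitX : forall k, X k \in unitmx).
Hypothesis wirtinger : forall c,
  X (over_arc D c) *m X (right_arc D c) = X (left_arc D c) *m X (over_arc D c).

Implicit Types (p q : passage n) (h : half_edge n) (c : 'I_n).
Local Notation prev := (finv (next D)).

Let conn : forall p q, fconnect (next D) p q. Proof. by case: knotD. Qed.
Let next_inj : injective (next D). Proof. exact: transitive_inj conn. Qed.

Lemma knot_arc_over c : arc D (c, true) = arc D (prev (c, true)).
Proof.
by have [m /arc_over_prev] := arc_back_exists next_inj (c, true) conn; apply.
Qed.

Lemma knot_card_faces : #|{: {h | froots (face_next D) h}}| = (n + 2)%N.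
Proof.
rewrite card_sig -(proj2 knotD); apply: eq_card => h.
by rewrite !inE andbT.
Qed.

Let face h : {h | froots (face_next D) h} :=
  exist _ (froot (face_next D) h)
    (roots_root (fconnect_sym (face_next_inj next_inj)) h).

Let face_const h : face (face_next D h) = face h.
Proof.
have sym := fconnect_sym (face_next_inj next_inj).
by apply: val_inj; apply/esym/eqP; rewrite /= (root_connect sym) fconnect1.
Qed.

Let face_next_half p : face (next D p, false) = face (rotate D (p, true)).
Proof. by rewrite -face_const /face_next /other_half /= (finv_f next_inj). Qed.

Let face_prev_half p : face (prev p, true) = face (rotate D (p, false)).
Proof. by rewrite -face_const /face_next /other_half /= (f_finv next_inj). Qed.

Let rowV := 'rV[K]_d.
Let C0 := {ffun {h | froots (face_next D) h} -> rowV}.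
Let C1 := {ffun passage n -> rowV}.
Let C2 := {ffun 'I_n -> rowV}.

(* The cellular cochain complex of the dual cell decomposition of the sphere, with
   coefficients in the local system given by [X]: going from the face on the left of
   an edge to the one on its right multiplies by the color of the edge. *)
Let d0 (f : C0) : C1 :=
  [ffun p => f (face (p, true)) - f (face (next D p, false)) *m X (arc D p)].

(** The value of a 1-cochain at [p] lies in the fibre of the face on the right of the edge leaving
    [p]. [outM] and [inM] transport such values, for the edges leaving and entering a passage, to
    the quadrant at the crossing that is to the right of both strands. *)
Let outM p : 'M[K]_d :=
  let o := X (over_arc D p.1) in let r := X (right_arc D p.1) in
  if p.2 then (if positive D p.1 then 1%:M else r)
  else (if positive D p.1 then o else 1%:M).

Let inM p : 'M[K]_d :=
  let o := X (over_arc D p.1) in let r := X (right_arc D p.1) in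
  if p.2 then (if positive D p.1 then r else 1%:M)
  else (if positive D p.1 then 1%:M else o).

Let d1 (g : C1) : C2 :=
  [ffun c => \sum_b (g (c, b) *m outM (c, b) - g (prev (c, b)) *m inM (c, b))].

Let delta c (v : rowV) : C2 := [ffun c' => if c' == c then v else 0].

Let d0_linear : linear d0.
Proof.
move=> a f g; apply/ffunP=> p; rewrite !ffunE mulmxDl -scalemxAl.
by rewrite scalerBr opprD addrACA.
Qed.
HB.instance Definition _ := GRing.isLinear.Build K C0 C1 _ d0 d0_linear.

Let d1_linear : linear d1.
Proof.
move=> a f g; apply/ffunP=> c; rewrite !ffunE scaler_sumr -big_split /=.
apply: eq_bigr => b _; rewrite !ffunE !mulmxDl -!scalemxAl.
by rewrite scalerBr opprD addrACA.
Qed.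
HB.instance Definition _ := GRing.isLinear.Build K C1 C2 _ d1 d1_linear.

Let delta_linear c : linear (delta c).
Proof.
move=> a f g; apply/ffunP=> c'; rewrite !ffunE.
by case: eqP => _; rewrite ?scaler0 ?addr0.
Qed.
HB.instance Definition _ c := GRing.isLinear.Build K rowV C2 _ (delta c) (delta_linear c).

(** By the Wirtinger relation, the two ways around the crossing from the quadrant left of both
    strands to the one right of both give the same transport. *)
Let d1_d0 f : d1 (d0 f) = 0.
Proof.
apply/ffunP=> c; rewrite !ffunE big_bool /outM /inM /= !ffunE.
rewrite !(f_finv next_inj) !face_prev_half !face_next_half -knot_arc_over.
rewrite -/(over_arc D c) -/(under_in D c) -/(under_out D c).
have := wirtinger c; rewrite /right_arc /left_arc /rotate.
case pos : (positive D c) => /= rel.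
  by rewrite !mulmx1 !mulmxBl -!mulmxA rel telescope4.
rewrite !mulmx1 !mulmxBl -!mulmxA rel addrC.
by rewrite telescope4.
Qed.

Let d1_delta p (v : rowV) :
  d1 [ffun q => if q == p then v else 0] =
    delta p.1 (v *m outM p) - delta (next D p).1 (v *m inM (next D p)).
Proof.
apply/ffunP=> c; rewrite !ffunE sumrB; congr (_ - _).
  case: p => c' b' /=; rewrite (bigD1 b') //= ffunE xpair_eqE eqxx andbT.
  rewrite big1 => [|b /negPf neq]; last by rewrite ffunE xpair_eqE neq andbF mul0mx.
  by case: eqP => [->|_]; rewrite ?mul0mx addr0.
have prevE q : (prev q == p) = (q == next D p).
  by rewrite (can2_eq (f_finv next_inj) (finv_f next_inj)).
case: (next D p) prevE => c' b' prevE /=.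
rewrite (bigD1 b') //= ffunE prevE xpair_eqE eqxx andbT.
rewrite big1 => [|b /negPf neq]; last by rewrite ffunE prevE xpair_eqE neq andbF mul0mx.
by case: eqP => [->|_]; rewrite ?mul0mx addr0.
Qed.

Let unit_inM p : inM p \in unitmx.
Proof. by rewrite /inM; do 2!case: ifP => _; rewrite ?unitmx1. Qed.

Let dim_row : dim rowV = d. Proof. by rewrite dim_matrix mul1r. Qed.

(* H^2 has dimension at most d: modulo coboundaries, a cochain can be moved along the
   edges to a single crossing. *)
Let rank_d1 : (n * d <= \dim (limg (linfun d1)) + d)%N.
Proof.
have [n0 | n_gt0] := posnP n; first by rewrite {1}n0.
pose c0 := Ordinal n_gt0.
pose U := (limg (linfun d1) + limg (linfun (delta c0)))%VS.
have deltaU c v : delta c v \in U.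
  have: fconnect (next D) (c0, true) (c, true) by [].
  move/iter_findex=> def_c; rewrite -[c]/((c, true).1) -{}def_c.
  elim: (findex _ _ _) v => [|k IH] v.
    rewrite -[delta _ _]add0r memv_add ?mem0v //=.
    by apply/memv_imgP; exists v; rewrite ?memvf ?lfunE.
  rewrite iterS; set p := iter k _ _ in IH *.
  have := d1_delta p (v *m invmx (inM (next D p))).
  rewrite mulmxKV ?unit_inM // => /eqP; rewrite eq_sym subr_eq addrC -subr_eq.
  move/eqP <-; apply: memvB; first exact: IH.
  rewrite -[d1 _]addr0 memv_add ?mem0v //.
  by rewrite -lfunE memv_img ?memvf.
have U_full : U = fullv.
  apply/vspaceP=> f; rewrite memvf.
  have -> : f = \sum_c delta c (f c).
    apply/ffunP=> c; rewrite sum_ffunE (bigD1 c) //= ffunE eqxx big1 ?addr0 //.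
    by move=> c' neq; rewrite ffunE eq_sym (negPf neq).
  by apply: memv_suml => c _; apply: deltaU.
have dimC2 : (\dim {:C2} = n * d)%N by rewrite dimvf /dim /= card_ord dim_matrix mul1r.
rewrite -dimC2 -U_full; apply: leq_trans (dimv_add_leqif _ _) _.
rewrite leq_add2l; apply: (@leq_trans (\dim (fullv : {vspace rowV}))).
  by rewrite -(limg_ker_dim (linfun (delta c0))) leq_addl.
by rewrite dimvf dim_row.
Qed.

(** The image of [d0] lies in the kernel of [d1], of dimension at most [2nd - (nd - d) = (n + 1)d],
    while [C0] has dimension [(n + 2)d] because there are [n + 2] faces. *)
Let ker_d0 : (d <= \dim (lker (linfun d0)))%N.
Proof.
have sub : (limg (linfun d0) <= lker (linfun d1))%VS.
  apply/subvP=> _ /memv_imgP[f _ ->].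
  by rewrite memv_ker !lfunE /= d1_d0.
have := limg_ker_dim (linfun d0) fullv; have := limg_ker_dim (linfun d1) fullv.
rewrite !capfv !dimvf /dim /= !dim_matrix !mul1r.
rewrite knot_card_faces card_prod card_ord card_bool.
move: (dimvS sub) rank_d1.
move: (\dim (lker (linfun d1))) (\dim (lker (linfun d0))) => k1 k0.
move: (\dim (limg (linfun d1))) (\dim (limg (linfun d0))) => r1 r0.
by rewrite mulnDl mulnAC; lia.
Qed.

Let ker_d0P (f : C0) : reflect
  (forall p, f (face (p, true)) = f (face (next D p, false)) *m X (arc D p))
  (f \in lker (linfun d0)).
Proof.
rewrite memv_ker lfunE; apply: (iffP eqP) => [/ffunP df p | df].
  by have := df p; rewrite !ffunE => /eqP; rewrite subr_eq0 => /eqP.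
by apply/ffunP=> p; rewrite !ffunE df subrr.
Qed.

(* A flat section vanishing at one half-edge vanishes everywhere, so that at least d
   independent ones give a basis of the fibre at h0. *)
Lemma flat_sections h0 : exists W : half_edge n -> 'M[K]_d,
  [/\ forall h, W (face_next D h) = W h,
      forall p, W (p, true) = W (next D p, false) *m X (arc D p)
    & W h0 = 1%:M].
Proof.
pose ev (f : C0) : rowV := f (face h0).
have ev_linear : linear ev by move=> a f g; rewrite /ev !ffunE.
pose ev_lin := GRing.isLinear.Build K C0 rowV _ ev ev_linear.
pose evL : {linear C0 -> rowV} := HB.pack ev ev_lin.
have ev_inj : (lker (linfun d0) :&: lker (linfun evL) = 0)%VS.
  apply/eqP; rewrite -subv0; apply/subvP=> f; rewrite memv_cap memv0.
  rewrite (memv_ker (linfun evL)) lfunE /= => /andP[/ker_d0P df /eqP f0].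
  have f_eq0 h : f (face h) = 0.
    apply: (half_edge_ind (h0 := h0) (P := fun h => f (face h) = 0) next_inj) => //.
      by move=> h'; rewrite face_const.
    move=> p; rewrite df; split=> [/(congr1 (mulmx^~ (invmx (X (arc D p))))) | ->].
      by rewrite mulmxK // mul0mx.
    by rewrite mul0mx.
  apply/eqP/ffunP=> -[h hroot]; rewrite !ffunE -(f_eq0 h); congr (f _).
  by apply: val_inj; rewrite /= (eqP hroot).
have ev_full : (linfun evL @: lker (linfun d0) = fullv)%VS.
  by apply/eqP; rewrite eqEdim subvf dimvf dim_row (limg_dim_eq ev_inj) ker_d0.
have flat_basis i : exists f : C0, f \in lker (linfun d0) /\ f (face h0) = delta_mx 0 i.
  have: delta_mx 0 i \in (linfun evL @: lker (linfun d0))%VS by rewrite ev_full memvf.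
  by case/memv_imgP=> f df; rewrite lfunE => ->; exists f.
have [F FP] := fin_all_exists flat_basis.
exists (fun h => \matrix_i F i (face h)); split=> [h | p |].
- by apply/row_matrixP=> i; rewrite !rowK face_const.
- apply/row_matrixP=> i; rewrite row_mul !rowK.
  by have [/ker_d0P] := FP i.
- by apply/row_matrixP=> i; rewrite rowK row1; have [] := FP i.
Qed.

End FlatSections.

(** * The Fox matrix and its kernels *)

Section WirtingerMatrix.
Variables (K : fieldType) (d n : nat) (D : diagram n) (X : 'I_n -> 'M[K]_d).
Local Notation prev := (finv (next D)).

Definition wirtinger_coloring : Prop := forall c,
  X (over_arc D c) *m X (right_arc D c) = X (left_arc D c) *m X (over_arc D c).

(* The image of the Fox derivative of the relator of [c] along the generator [k]. *)
Definition fox_block (c k : 'I_n) : 'M[K]_d :=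
  (if over_arc D c == k then 1%:M - X (left_arc D c) else 0)
  + (if right_arc D c == k then X (over_arc D c) else 0)
  - (if left_arc D c == k then 1%:M else 0).

(** This is the fundamental formula of Fox calculus: the sum is the image of 1 minus the relator, up
    to an invertible factor. *)
Lemma fox_block_right_kernel : wirtinger_coloring ->
  forall c, \sum_k fox_block c k *m (1%:M - X k) = 0.
Proof.
move=> rel c; have pick (a : 'I_n) (M : 'M[K]_d) :
    \sum_k (if a == k then M else 0) *m (1%:M - X k) = M *m (1%:M - X a).
  rewrite (bigD1 a) //= eqxx big1 ?addr0 // => k.
  by rewrite eq_sym => /negPf ->; rewrite mul0mx.
under eq_bigr do rewrite mulmxBl mulmxDl.
rewrite sumrB big_split /= !pick !mulmxBr !mulmxBl !mul1mx !mulmx1 rel.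
by rewrite subrK subrr.
Qed.

(* [T p] is the weight of the face on the left of the edge leaving [p] and [B c] is,
   up to sign, the weight of a face at [c]; the equations say that the jump of [T]
   along the strands through [c] is the contribution of the relation of [c]. *)
Definition crossing_weights_at (B : 'I_n -> 'M[K]_d) (T : passage n -> 'M[K]_d) c : Prop :=
  [/\ B c *m (1%:M - X (left_arc D c)) = T (c, true) - T (prev (c, true)),
      B c = (if positive D c then - T (c, false) else T (prev (c, false)))
    & B c *m X (over_arc D c) =
        (if positive D c then - T (prev (c, false)) else T (c, false))].

Definition crossing_weights B T : Prop := forall c, crossing_weights_at B T c.

Lemma crossing_weights_row B T c k : crossing_weights_at B T c ->
    arc D (c, true) = arc D (prev (c, true)) ->
  B c *m fox_block c k =
    \sum_b ((if arc D (c, b) == k then T (c, b) else 0) -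
            (if arc D (prev (c, b)) == k then T (prev (c, b)) else 0)).
Proof.
move=> [w1 w2 w3] over_eq.
have mulif (b : bool) (M N : 'M[K]_d) :
  M *m (if b then N else 0) = if b then M *m N else 0.
  by case: b; rewrite ?mulmx0.
rewrite /fox_block mulmxBr mulmxDr !mulif w1 w3 mulmx1 w2.
rewrite big_bool /= -over_eq -/(over_arc D c) -/(under_in D c) -/(under_out D c).
rewrite -addrA; congr (_ + _); first by case: ifP; rewrite ?subrr.
rewrite /right_arc /left_arc; case: positive.
  rewrite addrC; congr (_ + _); first by case: eqP; rewrite ?opprK ?oppr0.
  by case: eqP; rewrite ?oppr0.
by [].
Qed.

(** In the sum over all crossings each edge contributes once as outgoing and once as incoming, with
    opposite signs. *)
Lemma crossing_weights_kernel B T : injective (next D) -> crossing_weights B T ->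
    (forall c, arc D (c, true) = arc D (prev (c, true))) ->
  forall k, \sum_c B c *m fox_block c k = 0.
Proof.
move=> next_inj wBT over_eq k.
rewrite (eq_bigr _ (fun c _ => crossing_weights_row k (wBT c) (over_eq c))).
pose E p := if arc D p == k then T p else 0.
rewrite (pair_big predT predT (fun c b => E (c, b) - E (prev (c, b)))) /= sumrB.
rewrite [X in _ - X](eq_bigr (fun p => E (prev p))) => [|[]] //.
rewrite [X in X - _](eq_bigr E) => [|[]] //.
rewrite [X in X - _](reindex_onto prev (next D)) => [|p _] /=.
  by rewrite (eq_bigl predT) ?subrr // => p; rewrite f_finv ?eqxx.
exact: finv_f.
Qed.

Hypotheses (knotD : knot_diagram D) (unitX : forall k, X k \in unitmx).
Hypothesis wirt : wirtinger_coloring.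

(** The weights are the values of a flat section equal to the identity on the left of [e]. [P]
    abstracts a property of determinants stable both ways under the factors [\det (X k)]; it spreads
    from the value 1 to all faces. *)
Lemma knot_crossing_weights (e : passage n) : exists B T,
  [/\ crossing_weights B T, T e = 1%:M &
    forall P : K -> Prop, P 1 -> (forall k a, P (a * \det (X k)) <-> P a) ->
    forall p, P (\det (T p))].
Proof.
have [conn _] := knotD; have next_inj := transitive_inj conn.
have [W [Wface Wedge We]] := flat_sections knotD unitX wirt (next D e, false).
pose T p := W (next D p, false).
have Wout p : W (p, true) = T p *m X (arc D p) by [].
have Win p : W (p, false) = T (prev p) by rewrite /T (f_finv next_inj).
have Wrot_out p : W (rotate D (p, true)) = T p.
  by rewrite -[RHS]Wface /face_next /other_half /= (finv_f next_inj).
have Wrot_in p : W (rotate D (p, false)) = T (prev p) *m X (arc D (prev p)).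
  by rewrite -Wout -[RHS]Wface /face_next /other_half /= (f_finv next_inj).
(* Up to sign, [B c] is the value of [W] at the quadrant left of both strands. *)
exists (fun c => if positive D c then - T (c, false) else T (prev (c, false))), T.
split=> [c | // | P P1 PX p].
  have := (Wrot_out (c, true), Wrot_out (c, false), Wrot_in (c, true), Wrot_in (c, false)).
  rewrite /crossing_weights_at /rotate -(knot_arc_over knotD).
  rewrite -/(over_arc D c) -/(under_in D c) /right_arc /left_arc /=.
  case: (positive D c) => /= -[[[]]]; rewrite !(Wout, Win) => r1 r2 r3 r4.
    split=> //; first by rewrite mulNmx mulmxBr mulmx1 opprB r1 r2.
    by rewrite mulNmx -r2 -r3.
  split=> //; first by rewrite mulmxBr mulmx1 -r1 r4.
  by rewrite r1 r2.
pose PW h := P (\det (W h)).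
apply: (half_edge_ind (P := PW) next_inj conn _ _ (h0 := (next D e, false))) => //.
- by move=> h; rewrite /PW Wface.
- by move=> q; rewrite /PW Wedge det_mulmx.
- by rewrite /PW We det1.
Qed.

End WirtingerMatrix.

(** * Colorings with values in SL2 *)

(** The left side is the product rule applied to the relator word; since [o r o^-1 = l], its last
    two terms become [- l] and [- 1]. *)
Lemma fox_row_simpl (K : fieldType) (d : nat) (o r l : 'M[K]_d) (bo br bl : bool) :
    o \in unitmx -> l \in unitmx -> o *m r = l *m o ->
  (if bo then 1%:M else 0) + o *m ((if br then 1%:M else 0) +
    r *m ((if bo then - invmx o else 0) +
          invmx o *m (if bl then - invmx l else 0))) =
  (if bo then 1%:M - l else 0) + (if br then o else 0) - (if bl then 1%:M else 0).
Proof.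
move=> uo ul rel; have mulif (M N : 'M[K]_d) (b : bool) :
  M *m (if b then N else 0) = if b then M *m N else 0.
  by case: b; rewrite ?mulmx0.
rewrite !mulmxDr !mulif !mulmxN !mulmx1 !mulmxA rel mulmxK // mulmxV //.
rewrite addrCA [in RHS]addrAC [in RHS]addrC; congr (_ + _); rewrite addrA.
congr (_ + _); last by case: bl; rewrite ?oppr0.
by case: bo; rewrite ?addr0.
Qed.

Lemma fox_block_conj (K : fieldType) (d n : nat) (D : diagram n)
    (X Y : 'I_n -> 'M[K]_d) (P Q : 'M[K]_d) :
    P *m Q = 1%:M -> (forall k, Y k = P *m X k *m Q) ->
  forall c k, fox_block D Y c k = P *m fox_block D X c k *m Q.
Proof.
move=> PQ XY c k; have cif (b : bool) (M : 'M[K]_d) :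
    P *m (if b then M else 0) *m Q = if b then P *m M *m Q else 0.
  by case: b; rewrite // mulmx0 mul0mx.
rewrite /fox_block !mulmxBr !mulmxDr !mulmxBl !mulmxDl !cif !XY.
by rewrite !mulmxBr !mulmxBl !mulmx1 PQ.
Qed.

Lemma bminor_fox_conj (K : fieldType) (n : nat) (D : diagram n.+1)
    (X Y : 'I_n.+1 -> 'M[K]_2) (P Q : 'M[K]_2) c j :
    P *m Q = 1%:M -> (forall k, Y k = P *m X k *m Q) ->
  bminor (fox_block D Y) c j = bminor (fox_block D X) c j.
Proof.
move=> PQ XY; rewrite -[RHS](bdet_conj _ PQ); apply: eq_bdet => i k.
exact: fox_block_conj PQ XY _ _.
Qed.

Lemma wirtinger_coloring_conj (K : fieldType) (d n : nat) (D : diagram n)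
    (X Y : 'I_n -> 'M[K]_d) (P Q : 'M[K]_d) :
    Q *m P = 1%:M -> (forall k, Y k = P *m X k *m Q) ->
  wirtinger_coloring D X -> wirtinger_coloring D Y.
Proof.
move=> QP XY wirt c; rewrite !XY !mulmxA.
by do 2!rewrite -(mulmxA _ Q P) QP mulmx1; rewrite -!(mulmxA P) wirt.
Qed.

(** Two summands bring two denominators [q] where the sum has one. The extra factor [q] is the
    [(1 - t)^2] of the formula. *)
Lemma mulf_div_common (K : fieldType) (q a b c u : K) :
  q != 0 -> a = u * (b * c) -> a / q = u * (q * (b / q) * (c / q)).
Proof. by move=> q_neq0 ->; rewrite (mulrC q) divfK // !mulrA. Qed.

(** For trace two and determinant one this is [(1 - a) ^+ 2], the denominator of the invariant. *)
Lemma det_1subZ (K : fieldType) (a : K) (A : 'M[K]_2) :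
  \det (1%:M - a *: A) = 1 - a * \tr A + a ^+ 2 * \det A.
Proof.
have det2 (M : 'M[K]_2) : \det M = M 0 0 * M 1 1 - M 0 1 * M 1 0.
  rewrite (expand_det_row _ ord0) !big_ord_recl big_ord0 addr0 /cofactor.
  rewrite !det_mx11 !mxE /= expr0 mul1r expr1 mulN1r mulrN.
  by congr (M _ _ * M _ _ - M _ _ * M _ _); apply: val_inj.
have tr2 : \tr A = A 0 0 + A 1 1.
  rewrite /mxtrace !big_ord_recl big_ord0 addr0.
  by congr (A _ _ + A _ _); apply: val_inj.
rewrite !det2 tr2 !mxE /=; ring.
Qed.

Local Open Scope quotient_scope.

(** * Evaluation of Fox derivatives and the twisted Alexander polynomial *)

Section TwistedAlexander.
Variable F : fieldType.
Local Notation K := (ratfun F).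
Local Notation t := (tvar F).

Lemma tvar_neq0 : t != 0.
Proof. by rewrite tofrac_eq0 polyX_eq0. Qed.

Definition tpower (u : K) : Prop := exists p : int, u = t ^ p.

Lemma tpower1 : tpower 1.
Proof. by exists 0; rewrite expr0z. Qed.

Lemma tpowerM u v : tpower u -> tpower v -> tpower (u * v).
Proof. by move=> [p ->] [q ->]; exists (p + q); rewrite expfzDr ?tvar_neq0. Qed.

Lemma tpowerV u : tpower u -> tpower u^-1.
Proof. by move=> [p ->]; exists (- p); rewrite invr_expz. Qed.

Lemma tpower_neq0 u : tpower u -> u != 0.
Proof. by move=> [p ->]; rewrite expfz_neq0 ?tvar_neq0. Qed.

Definition embed (a : F) : K := tofrac a%:P.

Lemma embed_is_zmod_morphism : zmod_morphism embed.
Proof. by move=> a b; rewrite /embed polyCB tofracB. Qed.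
Lemma embed_is_monoid_morphism : monoid_morphism embed.
Proof. by split=> [|a b]; rewrite /embed ?polyC1 ?tofrac1 // polyCM tofracM. Qed.
HB.instance Definition _ := GRing.isZmodMorphism.Build F K embed embed_is_zmod_morphism.
HB.instance Definition _ := GRing.isMonoidMorphism.Build F K embed embed_is_monoid_morphism.

Definition tcolor n (f : 'I_n -> SL2 F) (k : 'I_n) : 'M[K]_2 :=
  t *: map_mx embed (sl2_mx (f k)).

Section Color.
Variables (n : nat) (f : 'I_n -> SL2 F).
Local Notation X := (tcolor f).

Lemma det_tcolor k : \det (X k) = t ^+ 2.
Proof. by rewrite detZ det_map_mx det_SL2 rmorph1 mulr1. Qed.

Lemma tpower_det_tcolor k : tpower (\det (X k)).
Proof. by exists 2; rewrite det_tcolor. Qed.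

Lemma unit_tcolor k : X k \in unitmx.
Proof. by rewrite unitmxE det_tcolor unitfE expf_neq0 ?tvar_neq0. Qed.

Definition eval_letter (x : 'I_n * bool) : 'M[K]_2 :=
  if x.2 then invmx (X x.1) else X x.1.

Lemma Phi_word_cons (x : 'I_n * bool) (w : word n) (e : int) :
  Phi f [:: (e, x :: w)] = eval_letter x *m Phi f [:: (e, w)].
Proof.
rewrite /Phi !big_seq1 /= /eval_word /exponent !big_cons.
rewrite -scaler_int -[in RHS]scaler_int -scalemxAr; congr (_ *: _).
rewrite expfzDr ?tvar_neq0 // -/embed.
have -> : forall A B : SL2 F, sl2_mx (A * B)%g = sl2_mx A *m sl2_mx B by [].
rewrite map_mxM -scalerA [in LHS]scalemxAr [in LHS]scalemxAl; congr (_ *m _).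
rewrite /eval_letter; case: x => k [] //=.
by rewrite invmxZ ?unit_tcolor // -map_invmx exprN1.
Qed.

Lemma Phi_cat (z1 z2 : zword n) : Phi f (z1 ++ z2) = Phi f z1 + Phi f z2.
Proof. exact: big_cat. Qed.

Lemma Phi_cons_word x (z : zword n) :
  Phi f [seq (m.1, x :: m.2) | m <- z] = eval_letter x *m Phi f z.
Proof.
elim: z => [|[e w] z IH]; first by rewrite /Phi big_nil mulmx0.
by rewrite /= -cat1s Phi_cat IH Phi_word_cons -mulmxDr -Phi_cat.
Qed.

Lemma Phi_nil (e : int) : Phi f [:: (e, [::])] = e%:~R%:M.
Proof.
rewrite /Phi big_seq1 /= /eval_word /exponent !big_nil expr0z scale1r.
rewrite -/embed [sl2_mx _](_ : _ = 1%:M) // map_mx1 -scaler_int scalemx1 //.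
Qed.

Lemma Phi_fox j x (w : word n) :
  Phi f (fox j (x :: w)) =
  (if x.1 == j then (if x.2 then - eval_letter x else 1%:M) else 0)
  + eval_letter x *m Phi f (fox j w).
Proof.
rewrite /= Phi_cat Phi_cons_word; congr (_ + _).
case: eqP => _; last by rewrite /Phi big_nil.
case: x.2; last by rewrite Phi_nil.
by rewrite Phi_word_cons Phi_nil mulrN1z -scalemx1 scaleN1r mulmxN mulmx1.
Qed.

Lemma Phi_fox_last j (x : 'I_n * bool) : Phi f (fox j [:: x]) =
  if x.1 == j then (if x.2 then - eval_letter x else 1%:M) else 0.
Proof. by rewrite Phi_fox [Phi _ _](_ : _ = 0) ?mulmx0 ?addr0 // /Phi big_nil. Qed.

Variable D : diagram n.
Hypothesis rep : representation D f.

Lemma tcolor_wirtinger : wirtinger_coloring D X.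
Proof.
move=> c; have := rep c; rewrite /eval_word /relator !big_cons big_nil /= mulg1.
move/(congr1 (fun g => g * f (left_arc D c) * f (over_arc D c))%g).
rewrite mul1g !mulgA !mulgVK => /(congr1 (@sl2_mx F)) /= rel.
by rewrite /tcolor -!scalemxAl -!scalemxAr -!map_mxM rel.
Qed.


Lemma Phi_fox_relator c k : Phi f (fox k (relator D c)) = fox_block D X c k.
Proof.

rewrite /relator 3!Phi_fox Phi_fox_last /fox_block.
exact: fox_row_simpl (unit_tcolor _) (unit_tcolor _) (tcolor_wirtinger c).
Qed.


End Color.

Lemma Phi_1sub n (f : 'I_n -> SL2 F) j :
  Phi f [:: (1, [::]); (-1, [:: (j, false)])] = 1%:M - tcolor f j.
Proof.
rewrite -cat1s Phi_cat Phi_nil; congr (_ + _).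
by rewrite Phi_word_cons Phi_nil mulrN1z -scalemx1 scaleN1r mulmxN mulmx1.
Qed.

Lemma det_1sub_tcolor n (f : 'I_n -> SL2 F) j : \tr (sl2_mx (f j)) = 2%:R ->
  \det (1%:M - tcolor f j) = (1 - t) ^+ 2.
Proof.
move=> tr_f; rewrite det_1subZ det_map_mx det_SL2 rmorph1 trace_map_mx.
by rewrite tr_f rmorph_nat; ring.
Qed.

Lemma twisted_alexanderE n (D : diagram n.+1) (f : 'I_n.+1 -> SL2 F) c j :
    representation D f -> (forall k, \tr (sl2_mx (f k)) = 2%:R) ->
  twisted_alexander D f c j =
    bminor (fox_block D (tcolor f)) c j / (1 - t) ^+ 2.
Proof.
move=> rep tr2; rewrite /twisted_alexander Phi_1sub (det_1sub_tcolor (tr2 j)).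
rewrite /alexander_mx bdet_mxblock; congr (_ / _).
by apply: eq_bdet => i k; rewrite Phi_fox_relator.
Qed.

Lemma tcolor_conj n (f : 'I_n -> SL2 F) (g : SL2 F) k :
  tcolor (fun i => f i ^ g)%g k =
    map_mx embed (sl2_mx g^-1%g) *m tcolor f k *m map_mx embed (sl2_mx g).
Proof.
rewrite /tcolor conjgE -scalemxAr -scalemxAl -!map_mxM -mulmxA.
by [].
Qed.

Lemma trace_SL2_conj (x g : SL2 F) : \tr (sl2_mx (x ^ g)%g) = \tr (sl2_mx x).
Proof. by rewrite conjgE /= mxtrace_mulC -mulmxA mulmxV ?unitmx_SL2 ?mulmx1. Qed.

(** The only other lift is the opposite matrix, whose trace is -2. *)
Lemma trace_two_lift_unique (x y : SL2 F) : 4%:R != 0 :> F ->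
    \tr (sl2_mx x) = 2%:R -> \tr (sl2_mx y) = 2%:R ->
  \pi_(PSL2 F) x = \pi_(PSL2 F) y -> x = y.
Proof.
move=> char_neq2 tr_x tr_y /eqmodP; rewrite /= /psl2_eqv => /orP[/eqP|/eqP] eq_xy.
  exact: val_inj.
case/eqP: char_neq2; move: tr_x; rewrite eq_xy linearN /= tr_y => /eqP.
by rewrite eq_sym -subr_eq0 opprK -natrD => /eqP.
Qed.

Lemma pi_PSL2_conj (x : SL2 F) (g : PSL2 F) :
  \pi_(PSL2 F) (x ^ repr g)%g = (\pi_(PSL2 F) x ^ g)%g.
Proof. by rewrite -{2}[g]reprK !conjgE [LHS]pi_PSL2_mul pi_PSL2_mul pi_PSL2_inv. Qed.

Lemma one_sub_tvar_neq0 : 1 - t != 0.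
Proof.
rewrite -tofrac1 -tofracB tofrac_eq0 subr_eq0 eq_sym -subr_eq0.
by rewrite -polyC1 polyXsubC_eq0.
Qed.

End TwistedAlexander.

(** * Cutting a diagram open *)

(* A diagram [D] cut open at the edge leaving [e] and spliced into [S]; the part of the
   arc of [e] behind the cut becomes part of the arc [a] of [S]. *)
Section Splice.
Variables (n N : nat) (D : diagram n) (S : diagram N) (i : 'I_n -> 'I_N).
Variables (e : passage n) (x : passage N) (m : nat) (a : 'I_N).
Hypothesis conn : forall p q, fconnect (next D) p q.
Hypotheses (S_inj : injective (next S)) (i_inj : injective i).
Hypothesis a_new : forall k, i k != a.
Local Notation prev := (finv (next D)).
Local Notation prevS := (finv (next S)).
Definition splice (p : passage n) : passage N := (i p.1, p.2).
Hypothesis prev_splice : forall p,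
  prevS (splice p) = if p == next D e then x else splice (prev p).

Let next_inj : injective (next D). Proof. exact: transitive_inj conn. Qed.

(** Walking back from [e] never crosses the cut: that would mean returning to [e] with fewer steps
    left to the same undercrossing, against the uniqueness of the step count. *)
Lemma splice_arc_back : exists k, arc_back S k (splice e) (i (arc D e)).
Proof.
have [k0 ba] := arc_back_exists next_inj e conn.
suff gen k p b : arc_back D k p b ->
    (exists k', arc_back S k' (splice p) (i b)) \/
    (exists2 k', (k' < k)%N & arc_back D k' e b).
  have [// | [k' lt_k' ba']] := gen _ _ _ ba.
  by rewrite (arc_back_unique ba ba') ltnn in lt_k'.
elim=> {k p b} [c | k c b bk IH].
  by left; exists 0%N; apply: ArcUnder.
case: (eqVneq (c, true) (next D e)) => [eq_c | neq_c].
  by right; exists k => //; rewrite eq_c (finv_f next_inj) in bk.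
case: IH => [[k' ba'] | [k' lt_k' ba']]; last by right; exists k'; rewrite // ltnW.
left; exists k'.+1; apply: ArcOver; rewrite -[(i c, true)]/(splice (c, true)).
by rewrite prev_splice (negPf neq_c).
Qed.

Hypothesis x_back : arc_back S m x a.

(** A backward walk either avoids the cut and ends as in [D], or crosses it and continues from [x]
    to the start of [a]; in the second case it was on the arc of [e]. *)
Lemma splice_arc_back_cases p : exists k,
  arc_back S k (splice p) (i (arc D p)) \/
  arc_back S k (splice p) a /\ arc D p = arc D e.
Proof.
have [k0 ba] := arc_back_exists next_inj p conn.
suff gen k q b : arc_back D k q b -> exists k',
    arc_back S k' (splice q) (i b) \/ arc_back S k' (splice q) a /\ b = arc D e.
  exact: gen ba.
elim=> {k q b} [c | k c b bk [k' IH]].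
  by exists 0%N; left; apply: ArcUnder.
case: (eqVneq (c, true) (next D e)) => [eq_c | neq_c].
  exists m.+1; right; split.
    apply: ArcOver; rewrite -[(i c, true)]/(splice (c, true)).
    by rewrite prev_splice eq_c eqxx.
  by rewrite eq_c (finv_f next_inj) in bk; rewrite (arc_backP next_inj bk).
exists k'.+1; case: IH => [ba' | [ba' eq_b]]; [left | right; split=> //];
  apply: ArcOver; rewrite -[(i c, true)]/(splice (c, true));
  by rewrite prev_splice (negPf neq_c).
Qed.

Definition spliced (b : 'I_N) (b' : 'I_n) : Prop :=
  b = i b' \/ b = a /\ b' = arc D e.

Lemma splice_arc p : spliced (arc S (splice p)) (arc D p).
Proof.
have [k [ba|[ba ->]]] := splice_arc_back_cases p; first by left; apply: arc_backP ba.
by right; rewrite (arc_backP S_inj ba).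
Qed.

Lemma splice_arc_prev p : spliced (arc S (prevS (splice p))) (arc D (prev p)).
Proof.
rewrite prev_splice; case: eqP => [-> | _]; last exact: splice_arc.
by right; rewrite (finv_f next_inj) (arc_backP S_inj x_back).
Qed.

Lemma splice_over c : arc S (i c, true) = arc S (prevS (i c, true)).
Proof.
by have [k [ba|[ba _]]] := splice_arc_back_cases (c, true); apply: arc_over_prev ba.
Qed.

Hypothesis sign_splice : forall c, positive S (i c) = positive D c.

Lemma splice_crossing c :
  [/\ spliced (over_arc S (i c)) (over_arc D c),
      spliced (left_arc S (i c)) (left_arc D c)
    & spliced (right_arc S (i c)) (right_arc D c)].
Proof.
rewrite /left_arc /right_arc sign_splice.
have u_out := splice_arc (c, false); have u_in := splice_arc_prev (c, false).
by split; [exact: (splice_arc (c, true)) | case: ifP | case: ifP].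
Qed.

Variables (K : fieldType) (d : nat) (X : 'I_N -> 'M[K]_d).
Hypothesis Xa : X a = X (i (arc D e)).
Local Notation Y := (fun k => X (i k)).

Lemma spliced_color b b' : spliced b b' -> X b = X (i b').
Proof. by case=> [-> | [-> ->]]. Qed.

(** The two pieces of the cut arc carry the same color, so only the columns of the pieces themselves
    can tell them apart. *)
Lemma splice_fox_block c k : k != arc D e ->
  fox_block S X (i c) (i k) = fox_block D Y c k.
Proof.
move=> k_e; have arc_eq b b' : spliced b b' -> (b == i k) = (b' == k).
  case=> [-> | [-> ->]]; first by rewrite (inj_eq i_inj).
  by rewrite eq_sym (negPf (a_new k)) eq_sym (negPf k_e).
have [so sl sr] := splice_crossing c; rewrite /fox_block.
by rewrite !(arc_eq _ _ so, arc_eq _ _ sl, arc_eq _ _ sr)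
  !(spliced_color so, spliced_color sl).
Qed.

Lemma splice_fox_block0 c k : k != a -> (forall k', i k' != k) ->
  fox_block S X (i c) k = 0.
Proof.
move=> k_a k_i; have arc_neq b b' : spliced b b' -> (b == k) = false.
  by case=> [-> | [-> _]]; [apply: negPf | rewrite eq_sym; apply: negPf].
have [so sl sr] := splice_crossing c; rewrite /fox_block.
by rewrite (arc_neq _ _ so) (arc_neq _ _ sl) (arc_neq _ _ sr) addr0 subr0.
Qed.

Lemma splice_crossing_weights (B : 'I_N -> 'M[K]_d) (T : passage N -> 'M[K]_d)
    (B' : 'I_n -> 'M[K]_d) (T' : passage n -> 'M[K]_d) c :
    (forall c, B (i c) = B' c) -> (forall p, T (splice p) = T' p) -> T x = T' e ->
  crossing_weights_at D Y B' T' c -> crossing_weights_at S X B T (i c).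
Proof.
move=> eB eT eTx; have eTprev b : T (prevS (i c, b)) = T' (prev (c, b)).
  rewrite -[(i c, b)]/(splice (c, b)) prev_splice; case: eqP => [-> | _] //.
  by rewrite (finv_f next_inj).
have [so sl _] := splice_crossing c.
rewrite /crossing_weights_at (spliced_color so) (spliced_color sl) sign_splice !eTprev eB.
by rewrite -(eT (c, true)) -(eT (c, false)).
Qed.

(* Everything telescopes except at the cut. *)
Lemma splice_weights_row (B : 'I_N -> 'M[K]_d) (T : passage N -> 'M[K]_d) k :
    crossing_weights S X B T -> T x = T (splice e) ->
  \sum_c B (i c) *m fox_block S X (i c) k =
    (if arc S (splice e) == k then T (splice e) else 0) -
    (if a == k then T (splice e) else 0).
Proof.
move=> wBT Tx; pose E p := if arc S p == k then T p else 0.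
rewrite (eq_bigr _ (fun c _ => crossing_weights_row k (wBT (i c)) (splice_over c))).
rewrite (pair_big predT predT (fun c b => E (i c, b) - E (prevS (i c, b)))) /= sumrB.
rewrite [X in X - _](eq_bigr (fun p => E (splice p))) => [|[]] //.
rewrite [X in _ - X](eq_bigr (fun p => if p == next D e then E x else E (splice (prev p))))
  => [|p _]; last by rewrite -[(i p.1, p.2)]/(splice p) prev_splice; case: eqP.
rewrite [X in X - _](reindex_onto prev (next D)) => [|p _] /=; last exact: finv_f.
rewrite (eq_bigl predT) => [|p]; last by rewrite /= (f_finv next_inj) eqxx.
rewrite (bigD1 (next D e)) //= [X in _ - X](bigD1 (next D e)) //= eqxx (finv_f next_inj).
rewrite [X in _ - (_ + X)](eq_bigr (fun p => E (splice (prev p)))).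
  by rewrite opprD addrACA subrr addr0 /E (arc_backP S_inj x_back) Tx.
by move=> p /negPf ->.
Qed.

End Splice.

(** * Minors of the connected sum *)

Section Minors.
Variables (K : fieldType) (U : K -> Prop).
Hypotheses (U1 : U 1) (UM : forall u v, U u -> U v -> U (u * v)).
Hypotheses (UV : forall u, U u -> U u^-1) (U_neq0 : forall u, U u -> u != 0).

(** [U] is a group of nonzero scalars, later the powers of [t]. *)
Definition eq_mod_units (a b : K) : Prop := exists2 u, U u & a = u * b.

Lemma eq_mod_units_trans a b c :
  eq_mod_units a b -> eq_mod_units b c -> eq_mod_units a c.
Proof.
by move=> [u Uu ->] [v Uv ->]; exists (u * v); [exact: UM | rewrite mulrA].
Qed.

Lemma eq_mod_unitsM a b c d :
  eq_mod_units a b -> eq_mod_units c d -> eq_mod_units (a * c) (b * d).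
Proof.
by move=> [u Uu ->] [v Uv ->]; exists (u * v); [exact: UM | rewrite mulrACA].
Qed.

Lemma eq_mod_units_cross u v a b : U u -> U v -> u * a = v * b -> eq_mod_units a b.
Proof.
move=> Uu Uv eq_ab; exists (u^-1 * v); first by apply: UM => //; apply: UV.
by rewrite -mulrA -eq_ab mulKf ?U_neq0.
Qed.

Section Diagram.
Variables (n : nat) (D : diagram n.+1) (X : 'I_n.+1 -> 'M[K]_2) (q : K).
Hypotheses (q_neq0 : q != 0) (det_q : forall k, \det (1%:M - X k) = q).
Hypothesis wirt : wirtinger_coloring D X.

(** Changing the removed row costs a ratio of determinants of the [B c], which are units. Changing
    the removed column costs nothing, since all [1 - X k] have the same determinant [q]. *)
Lemma bminor_fox_indep (B : 'I_n.+1 -> 'M[K]_2) c j c' j' :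
    (forall c, U (\det (B c))) -> (forall k, \sum_c B c *m fox_block D X c k = 0) ->
  eq_mod_units (bminor (fox_block D X) c j) (bminor (fox_block D X) c' j').
Proof.
move=> UB kerB; apply: (eq_mod_units_cross (UB c') (UB c)).
rewrite (bminor_row_exchange c' c j kerB); congr (_ * _).
apply: (mulfI q_neq0); rewrite -{1}(det_q j') -(det_q j).
exact: (bminor_col_exchange c' j' j (fox_block_right_kernel wirt)).
Qed.

Hypotheses (knotD : knot_diagram D) (U_X : forall k, U (\det (X k))).

Lemma knot_unit_weights (e : passage n.+1) : exists B T,
  [/\ crossing_weights D X B T, T e = 1%:M, forall c, U (\det (B c)) &
      forall k, \sum_c B c *m fox_block D X c k = 0].
Proof.
have unitX k : X k \in unitmx by rewrite unitmxE unitfE U_neq0.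
have [B [T [wBT Te UT]]] := knot_crossing_weights knotD unitX wirt e.
have {}UT : forall p, U (\det (T p)).
  apply: UT => // k a; split=> [Ua | Ua]; last exact: UM.
  by rewrite -[a](mulfK (U_neq0 (U_X k))); apply: UM => //; apply: UV.
exists B, T; split=> // [c | k].
  have [_ -> _] := wBT c; case: ifP => _; last exact: UT.
  (* The sign disappears because the blocks have even size. *)
  by rewrite -scaleN1r detZ sqrrN expr1n mul1r.
apply: crossing_weights_kernel wBT (knot_arc_over knotD) k.
by apply: transitive_inj; case: knotD.
Qed.

End Diagram.
End Minors.

(** * The connected sum as two mutually spliced diagrams *)

Section ConnectedSum.
Variables (n1 n2 : nat) (D1 : diagram n1) (D2 : diagram n2).
Variables (e1 : passage n1) (e2 : passage n2).
Hypothesis conn1 : forall p q, fconnect (next D1) p q.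
Hypothesis conn2 : forall p q, fconnect (next D2) p q.
Local Notation S := (csum_diagram D1 D2 e1 e2).
Local Notation l := (@lshift n1 n2).
Local Notation r := (@rshift n1 n2).

Lemma csum_next_l p : next S (splice l p) =
  if p == e1 then splice r (next D2 e2) else splice l (next D1 p).
Proof. by case: p => c b; rewrite /= /csum_next /= (unsplitK (inl _)). Qed.

Lemma csum_next_r p : next S (splice r p) =
  if p == e2 then splice l (next D1 e1) else splice r (next D2 p).
Proof. by case: p => c b; rewrite /= /csum_next /= (unsplitK (inr _)). Qed.

Lemma csum_passage_ind (P : passage (n1 + n2) -> Prop) :
    (forall p, P (splice l p)) -> (forall p, P (splice r p)) -> forall p, P p.
Proof.
move=> Pl Pr [c b]; rewrite -(splitK c); case: split => i.
  exact: (Pl (i, b)).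
exact: (Pr (i, b)).
Qed.

Let inj1 : injective (next D1). Proof. exact: transitive_inj conn1. Qed.
Let inj2 : injective (next D2). Proof. exact: transitive_inj conn2. Qed.

(** Predecessors are first given through [next S], since [finv] inverts only an injective map; their
    existence yields surjectivity and hence injectivity. *)
Let csum_prev_l' p : next S (if p == next D1 e1 then splice r e2
  else splice l (finv (next D1) p)) = splice l p.
Proof.
case: eqP => [-> | neq_p]; first by rewrite csum_next_r eqxx.
rewrite csum_next_l (f_finv inj1); case: eqP => // eq_e.
by case: neq_p; rewrite -eq_e (f_finv inj1).
Qed.

Let csum_prev_r' p : next S (if p == next D2 e2 then splice l e1
  else splice r (finv (next D2) p)) = splice r p.
Proof.
case: eqP => [-> | neq_p]; first by rewrite csum_next_l eqxx.
rewrite csum_next_r (f_finv inj2); case: eqP => // eq_e.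
by case: neq_p; rewrite -eq_e (f_finv inj2).
Qed.

Lemma csum_next_inj : injective (next S).
Proof.
apply: next_surj_inj; apply: csum_passage_ind => p; eexists.
  exact: csum_prev_l'.
exact: csum_prev_r'.
Qed.

Lemma csum_prev_l p : finv (next S) (splice l p) =
  if p == next D1 e1 then splice r e2 else splice l (finv (next D1) p).
Proof. by apply: csum_next_inj; rewrite (f_finv csum_next_inj) csum_prev_l'. Qed.

Lemma csum_prev_r p : finv (next S) (splice r p) =
  if p == next D2 e2 then splice l e1 else splice r (finv (next D2) p).
Proof. by apply: csum_next_inj; rewrite (f_finv csum_next_inj) csum_prev_r'. Qed.

Lemma csum_positive_l c : positive S (l c) = positive D1 c.
Proof. by rewrite /= (unsplitK (inl _)). Qed.

Lemma csum_positive_r c : positive S (r c) = positive D2 c.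
Proof. by rewrite /= (unsplitK (inr _)). Qed.

Lemma csum_arc_l : exists k, arc_back S k (splice l e1) (l (arc D1 e1)).
Proof. exact: splice_arc_back conn1 csum_prev_l. Qed.

Lemma csum_arc_r : exists k, arc_back S k (splice r e2) (r (arc D2 e2)).
Proof. exact: splice_arc_back conn2 csum_prev_r. Qed.

End ConnectedSum.

Section ConnectedSumMinors.
Variables (K : fieldType) (U : K -> Prop).
Hypotheses (U1 : U 1) (UM : forall u v, U u -> U v -> U (u * v)).
Hypotheses (UV : forall u, U u -> U u^-1) (U_neq0 : forall u, U u -> u != 0).
Variables (n1 n2 : nat) (D1 : diagram n1.+1) (D2 : diagram n2.+1).
Variables (e1 : passage n1.+1) (e2 : passage n2.+1).
Hypotheses (knot1 : knot_diagram D1) (knot2 : knot_diagram D2).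
Local Notation S := (csum_diagram D1 D2 e1 e2).
Local Notation l := (@lshift n1.+1 n2.+1).
Local Notation r := (@rshift n1.+1 n2.+1).
Variables (X : 'I_(n1.+1 + n2.+1) -> 'M[K]_2) (q : K).
Local Notation X1 := (fun k => X (l k)).
Local Notation X2 := (fun k => X (r k)).
Hypotheses (q_neq0 : q != 0) (det_q : forall k, \det (1%:M - X k) = q).
Hypothesis U_X : forall k, U (\det (X k)).
Hypotheses (wirt1 : wirtinger_coloring D1 X1) (wirt2 : wirtinger_coloring D2 X2).
Hypothesis wirt : wirtinger_coloring S X.
Hypothesis X_cut : X (l (arc D1 e1)) = X (r (arc D2 e2)).

Let conn1 : forall p q, fconnect (next D1) p q. Proof. by case: knot1. Qed.
Let conn2 : forall p q, fconnect (next D2) p q. Proof. by case: knot2. Qed.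

Let l_inj : injective l. Proof. exact: lshift_inj. Qed.
Let r_inj : injective r. Proof. exact: rshift_inj. Qed.
Let l_neq_r i j : l i != r j. Proof. by rewrite eq_lrshift. Qed.
Let r_neq_l i j : r i != l j. Proof. by rewrite eq_rlshift. Qed.

Let S_inj : injective (next S). Proof. exact: csum_next_inj. Qed.
Let prev_l := @csum_prev_l _ _ D1 D2 e1 e2 conn1 conn2.
Let prev_r := @csum_prev_r _ _ D1 D2 e1 e2 conn1 conn2.
Let sign_l := csum_positive_l D1 D2 e1 e2.
Let sign_r := csum_positive_r D1 D2 e1 e2.

(** Weights of [D1] and [D2], both normalised to 1 on the left of the cut edge, agree at the cut and
    glue to weights of the sum. Planarity enters through the two summands only. *)
Lemma csum_unit_weights : exists B T,
  [/\ crossing_weights S X B T, T (splice l e1) = T (splice r e2),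
      T (splice r e2) = 1%:M, forall c, U (\det (B c)) &
      forall k, \sum_c B c *m fox_block S X c k = 0].
Proof.
have [k1 ba1] := @csum_arc_l _ _ D1 D2 e1 e2 conn1 conn2.
have [k2 ba2] := @csum_arc_r _ _ D1 D2 e1 e2 conn1 conn2.
have [B1 [T1 [w1 T1e UB1 _]]] :=
  knot_unit_weights U1 UM UV U_neq0 wirt1 knot1 (fun k => U_X (l k)) e1.
have [B2 [T2 [w2 T2e UB2 _]]] :=
  knot_unit_weights U1 UM UV U_neq0 wirt2 knot2 (fun k => U_X (r k)) e2.
pose B c := match split c with inl c => B1 c | inr c => B2 c end.
pose T (p : passage (n1.+1 + n2.+1)) :=
  match split p.1 with inl c => T1 (c, p.2) | inr c => T2 (c, p.2) end.
have Bl c : B (l c) = B1 c by rewrite /B (unsplitK (inl _)).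
have Br c : B (r c) = B2 c by rewrite /B (unsplitK (inr _)).
have Tl p : T (splice l p) = T1 p by case: p => c b; rewrite /T (unsplitK (inl _)).
have Tr p : T (splice r p) = T2 p by case: p => c b; rewrite /T (unsplitK (inr _)).
have split_ind (P : 'I_(n1.+1 + n2.+1) -> Prop) :
    (forall c, P (l c)) -> (forall c, P (r c)) -> forall c, P c.
  by move=> Pl Pr c; rewrite -(splitK c); case: split => c'; [exact: Pl | exact: Pr].
have wBT : crossing_weights S X B T.
  apply: split_ind => c.
    apply: (splice_crossing_weights conn1 S_inj prev_l ba2 sign_l _ Bl Tl) => //.
    by rewrite Tr T1e T2e.
  apply: (splice_crossing_weights conn2 S_inj prev_r ba1 sign_r _ Br Tr) => //.
  by rewrite Tl T1e T2e.
exists B, T; split; rewrite ?Tl ?Tr ?T1e ?T2e //.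
  by apply: split_ind => c; rewrite ?Bl ?Br.
apply: crossing_weights_kernel S_inj wBT _; apply: split_ind => c.
  exact: (splice_over conn1 S_inj prev_l ba2).
exact: (splice_over conn2 S_inj prev_r ba1).
Qed.

Lemma csum_bminor c1 c2 :
  eq_mod_units U (bminor (fox_block S X) (l c1) (l (arc D1 e1)))
    (bminor (fox_block D1 X1) c1 (arc D1 e1) * bminor (fox_block D2 X2) c2 (arc D2 e2)).
Proof.
have [k1 ba1] := @csum_arc_l _ _ D1 D2 e1 e2 conn1 conn2.
have [k2 ba2] := @csum_arc_r _ _ D1 D2 e1 e2 conn1 conn2.
have [B [T [wBT Te T1 UB _]]] := csum_unit_weights.
set A := fox_block S X.
have A_l i k : k != arc D1 e1 -> A (l i) (l k) = fox_block D1 X1 i k.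
  apply: (splice_fox_block conn1 S_inj l_inj _ prev_l ba2 sign_l) => //.
have A_r i k : k != arc D2 e2 -> A (r i) (r k) = fox_block D2 X2 i k.
  apply: (splice_fox_block conn2 S_inj r_inj _ prev_r ba1 sign_r) => //.
(* The only arc labelled in [D1] that a crossing of [D2] can meet is the connecting arc, whose
   column is removed. *)
have A_rl i k : k != arc D1 e1 -> A (r i) (l k) = 0.
  move=> neq; apply: (splice_fox_block0 conn2 S_inj prev_r ba1 sign_r) => //.
(* The weighted sum of the rows of the lower block telescopes to the identity in column [arc D2 e2];
   the opposite term lies in the removed column. *)
have minor_r : \det (B (r c2)) * bdet (fun i k => A (r i) (r k)) =
    bminor (fox_block D2 X2) c2 (arc D2 e2).
  rewrite (@bdet_comb_row _ _ (fun i k => A (r i) (r k)) (fun c => B (r c)) 1%:M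
    _ (arc D2 e2)).
    rewrite det1 mul1r; apply: eq_bdet => i k.
    by rewrite A_r // eq_sym neq_lift.
  move=> k; rewrite (splice_weights_row conn2 S_inj prev_r ba1 _ wBT) //.
  rewrite (arc_backP S_inj ba2) (inj_eq r_inj) (negPf (l_neq_r _ _)) subr0 T1.
  by rewrite eq_sym.
have minor_split : bminor A (l c1) (l (arc D1 e1)) =
    bminor (fox_block D1 X1) c1 (arc D1 e1) * bdet (fun i k => A (r i) (r k)).
  (* [n1.+1 + n2.+1] is convertible to [(n1 + n2.+1).+1]: the minor keeps [n1] indices of the first
     diagram and all [n2.+1] of the second. *)
  pose f (x : 'I_n1 + 'I_n2.+1) : 'I_(n1 + n2.+1) := unsplit x.
  have bij_f : bijective f by exists split; [exact: unsplitK | exact: splitK].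
  have lift_l (j : 'I_n1.+1) (i : 'I_n1) :
      lift (l j) (f (inl i)) = l (lift j i) :> 'I_(n1.+1 + n2.+1).
    exact: val_inj.
  have lift_r (j : 'I_n1.+1) (i : 'I_n2.+1) :
      lift (l j) (f (inr i)) = r i :> 'I_(n1.+1 + n2.+1).
    (* The removed index precedes all those of the second diagram, hence the shift by one. *)
    apply: val_inj; rewrite /= /bump (leq_trans _ (leq_addr i n1)) ?add1n //.
    by rewrite -ltnS.
  rewrite /bminor -(bdet_bij _ bij_f) bdet_sum => [|i k].
    congr (_ * _); apply: eq_bdet => i k; rewrite ?lift_l ?lift_r //.
    by rewrite A_l // eq_sym neq_lift.
  by rewrite lift_l lift_r A_rl // eq_sym neq_lift.
exists (\det (B (r c2)))^-1; first exact: UV.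
by rewrite minor_split -minor_r mulrCA mulKf ?U_neq0.
Qed.

Lemma csum_bminor_indep c j c' j' :
  eq_mod_units U (bminor (fox_block S X) c j) (bminor (fox_block S X) c' j').
Proof.
have [B [T [_ _ _ UB kerB]]] := csum_unit_weights.
exact: (@bminor_fox_indep _ _ UM UV U_neq0 (n1 + n2.+1) S X q q_neq0 det_q wirt B).
Qed.

Lemma csum_bminor_any c1 j1 c2 j2 c j :
  eq_mod_units U (bminor (fox_block S X) c j)
    (bminor (fox_block D1 X1) c1 j1 * bminor (fox_block D2 X2) c2 j2).
Proof.
apply: (eq_mod_units_trans UM (csum_bminor_indep c j (l c1) (l (arc D1 e1)))).
apply: (eq_mod_units_trans UM (csum_bminor c1 c2)).
have [B1 [_ [_ _ UB1 ker1]]] :=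
  knot_unit_weights U1 UM UV U_neq0 wirt1 knot1 (fun k => U_X (l k)) e1.
have [B2 [_ [_ _ UB2 ker2]]] :=
  knot_unit_weights U1 UM UV U_neq0 wirt2 knot2 (fun k => U_X (r k)) e2.
apply: (eq_mod_unitsM UM).
  exact: (bminor_fox_indep UM UV U_neq0 q_neq0 (fun k => det_q (l k)) wirt1
    _ _ _ _ UB1 ker1).
exact: (bminor_fox_indep UM UV U_neq0 q_neq0 (fun k => det_q (r k)) wirt2
  _ _ _ _ UB2 ker2).
Qed.

End ConnectedSumMinors.

(** * The product formula for connected sums *)

Theorem corollary4p2 (R : realType) (n1 n2 : nat)
    (D1 : diagram n1.+1) (D2 : diagram n2.+1)
    (rho1 : 'I_n1.+1 -> PSL2 R[i]) (rho2 : 'I_n2.+1 -> PSL2 R[i])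
    (lrho1 : 'I_n1.+1 -> SL2 R[i]) (lrho2 : 'I_n2.+1 -> SL2 R[i])
    (e1 : passage n1.+1) (e2 : passage n2.+1)
    (rho : 'I_(n1.+1 + n2.+1) -> PSL2 R[i])
    (lrho : 'I_(n1.+1 + n2.+1) -> SL2 R[i])
    (c1 j1 : 'I_n1.+1) (c2 j2 : 'I_n2.+1) (c j : 'I_(n1.+1 + n2.+1)) :
  knot_diagram D1 -> knot_diagram D2 ->
  boundary_parabolic D1 rho1 -> boundary_parabolic D2 rho2 ->
  trace_two_lift D1 rho1 lrho1 -> trace_two_lift D2 rho2 lrho2 ->
  connected_sum_rep D1 D2 e1 e2 rho1 rho2 rho ->
  trace_two_lift (csum_diagram D1 D2 e1 e2) rho lrho ->
  eq_up_to_tpow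
    (twisted_alexander (csum_diagram D1 D2 e1 e2) lrho c j)
    ((1 - tvar R[i]) ^+ 2 *
      twisted_alexander D1 lrho1 c1 j1 * twisted_alexander D2 lrho2 c2 j2).
Proof.
move=> knot1 knot2 _ _ [rep1 pi1 tr1] [rep2 pi2 tr2] [g1 [g2 [cut def_rho]]].
move=> [rep pi_lrho tr_lrho].
have char_neq2 : 4%:R != 0 :> R[i] by rewrite Num.Theory.pnatr_eq0.
have lift_unique := trace_two_lift_unique char_neq2.
(* Trace two singles out the lift, so on each summand [lrho] is the given lift conjugated by a
   representative of [g1] or [g2]. *)
have lrho_l k : lrho (lshift n2.+1 k) = (lrho1 k ^ repr g1)%g.
  apply: lift_unique; rewrite ?trace_SL2_conj ?tr_lrho ?tr1 //.
  by rewrite pi_PSL2_conj pi_lrho pi1 def_rho /csum_coloring (unsplitK (inl _)).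
have lrho_r k : lrho (rshift n1.+1 k) = (lrho2 k ^ repr g2)%g.
  apply: lift_unique; rewrite ?trace_SL2_conj ?tr_lrho ?tr2 //.
  by rewrite pi_PSL2_conj pi_lrho pi2 def_rho /csum_coloring (unsplitK (inr _)).
have lrho_cut : lrho (lshift n2.+1 (arc D1 e1)) = lrho (rshift n1.+1 (arc D2 e2)).
  apply: lift_unique; rewrite ?tr_lrho // lrho_l lrho_r !pi_PSL2_conj pi1 pi2.
  exact: cut.
pose P (g : PSL2 R[i]) := map_mx (@embed R[i]) (sl2_mx (repr g)^-1%g).
pose Q (g : PSL2 R[i]) := map_mx (@embed R[i]) (sl2_mx (repr g)).
have PQ g : P g *m Q g = 1%:M by rewrite -map_mxM mulVmx ?unitmx_SL2 ?map_mx1.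
have QP g : Q g *m P g = 1%:M by rewrite -map_mxM mulmxV ?unitmx_SL2 ?map_mx1.
set X := tcolor lrho.
have X_l k : X (lshift n2.+1 k) = P g1 *m tcolor lrho1 k *m Q g1.
  by rewrite /X /tcolor lrho_l; exact: (tcolor_conj lrho1 (repr g1) k).
have X_r k : X (rshift n1.+1 k) = P g2 *m tcolor lrho2 k *m Q g2.
  by rewrite /X /tcolor lrho_r; exact: (tcolor_conj lrho2 (repr g2) k).
have q_neq0 : (1 - tvar R[i]) ^+ 2 != 0 by rewrite expf_neq0 ?one_sub_tvar_neq0.
have det_q k : \det (1%:M - X k) = (1 - tvar R[i]) ^+ 2 by rewrite det_1sub_tcolor.
have wirt_l := wirtinger_coloring_conj (QP g1) X_l (tcolor_wirtinger rep1).
have wirt_r := wirtinger_coloring_conj (QP g2) X_r (tcolor_wirtinger rep2).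
have X_cut : X (lshift n2.+1 (arc D1 e1)) = X (rshift n1.+1 (arc D2 e2)).
  by rewrite /X /tcolor lrho_cut.
have [u [p ->] eq_minor] := csum_bminor_any (tpower1 _) (@tpowerM _) (@tpowerV _)
  (@tpower_neq0 _) knot1 knot2 q_neq0 det_q (tpower_det_tcolor lrho) wirt_l wirt_r
  (tcolor_wirtinger rep) X_cut c1 j1 c2 j2 c j.
(* Block minors are invariant under a common conjugation, so the summands return to their original
   lifts. *)
rewrite (bminor_fox_conj D1 c1 j1 (PQ _) X_l) in eq_minor.
rewrite (bminor_fox_conj D2 c2 j2 (PQ _) X_r) in eq_minor.
exists p.
rewrite (@twisted_alexanderE _ (n1 + n2.+1) (csum_diagram D1 D2 e1 e2) lrho c j rep tr_lrho).
rewrite (twisted_alexanderE _ _ rep1 tr1) (twisted_alexanderE _ _ rep2 tr2).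
exact: mulf_div_common q_neq0 eq_minor.
Qed.
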